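(* Let $R$ be a Dedekind domain with fraction field $K$, let $R[x]=R[x_1,\dots,x_n]$ be equipped with a monomial ordering $<$, and let $F=(f_i,\mathfrak f_i)_{1\le i\le l}$ be a finite family of non-zero pseudo-polynomials of $R[x]$ such that $\langle F\rangle$ contains a non-zero ideal $\mathfrak N$ of $R$. Consider the following procedure: (0) Add $(1,\mathfrak N)$ to $F$. (1) Initialize $\tilde G$ as the set of all pairs of (distinct) members of $F$ and $G=F$. (2) While $\tilde G\neq\emptyset$, repeat: (a) pick a pair $((f,\mathfrak f),(g,\mathfrak g))\in\tilde G$, remove it from $\tilde G$, and compute a pseudo-polynomial $(h,\mathfrak h)$ such that $\operatorname{spoly}((f,\mathfrak f),(g,\mathfrak g))$ reduces to $(h,\mathfrak h)$ modulo $G$ and either $h=0$ or $(h,\mathfrak h)$ is minimal with respect to $G$; (a') if $h\ne0$, choose a non-zero pseudo-polynomial $(g_1,\mathfrak g_1)$ with $\mathfrak g_1g_1=\mathfrak hh$, write $g_1=\sum_ic_{\alpha_i}x^{\alpha_i}$ with $c_{\alpha_i}\neq0$, choose a polynomial $g_2=\sum_i\bar c_{\alpha_i}x^{\alpha_i}\in K[x]$ with $c_{\alpha_i}-\bar c_{\alpha_i}\in\mathfrak N\mathfrak g_1^{-1}$ for all $i$, and replace $(h,\mathfrak h)$ by $(g_2,\mathfrak g_1)$; (b) if $h\neq0$, replace $\tilde G$ by $\tilde G\cup\{((f,\mathfrak f),(h,\mathfrak h))\mid(f,\mathfrak f)\in G\}$ and then $G$ by $G\cup\{(h,\mathfrak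 h)\}$. (3) Return $G$. Then (for any choices made) this procedure is correct: it terminates after finitely many steps and returns a pseudo-Gröbner basis $G$ of $\langle F\rangle$.
   Context: A Dedekind domain is a Noetherian integrally closed domain of Krull dimension one. A monomial ordering is a total well-ordering on monomials compatible with multiplication. For non-zero $f=\sum_\alpha c_\alpha x^\alpha\in K[x]$, $\deg(f)\in\mathbb N^n$ is the largest exponent $\alpha$ (with respect to $<$) with $c_\alpha\ne0$; $\operatorname{lm}(f)=x^{\deg(f)}$, $\operatorname{lc}(f)=c_{\deg(f)}$, $\operatorname{lt}(f)=\operatorname{lc}(f)\operatorname{lm}(f)$. A fractional ideal of $R$ is a non-zero finitely generated $R$-submodule of $K$; for a fractional ideal $\mathfrak a$, $\mathfrak a[x]$ is the set of polynomials in $K[x]$ with all coefficients in $\mathfrak a$. A pseudo-polynomial of $R[x]$ is a pair $(f,\mathfrak f)$ with $f\in K[x]$ and $\mathfrak f$ a fractional ideal of $R$ such that $\mathfrak f f\subseteq R[x]$; it is zero if $f=0$. Put $\operatorname{lc}(f,\mathfrak f)=\mathfrak f\operatorname{lc}(f)$ and $\langle(f,\mathfrak f)\rangle=\mathfrak f[x]f$; for a finite family $G=(g_i,\mathfrak g_i)_i$ put $\langle G\rangle=\sum_i\mathfrak g_i[x]g_i$. Reduction: let $(f,\mathfrak f)$ and $G=\{(g_i,\mathfrak g_i)\}$ be non-zero pseudo-polynomials and $J=\{i\mid \operatorname{lm}(g_i)\text{ divides }\operatorname{lm}(f)\}$. $(f,\mathfrak f)$ can be reduced modulo $G$ if $\operatorname{lc}(f,\mathfrak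 f)\subseteq\sum_{i\in J}\operatorname{lc}(g_i,\mathfrak g_i)$, and is minimal with respect to $G$ otherwise. Reducibility is equivalent to the existence of $a_i\in\mathfrak g_i\mathfrak f^{-1}$, $i\in J$, with $\operatorname{lc}(f)=\sum_{i\in J}a_i\operatorname{lc}(g_i)$; for any such choice, $(f-\sum_{i\in J}a_ix^{\deg(f)-\deg(g_i)}g_i,\ \mathfrak f)$ is called a one step reduction of $(f,\mathfrak f)$. $(f,\mathfrak f)$ reduces to $(h,\mathfrak f)$ modulo $G$ if $(h,\mathfrak f)$ is obtained from $(f,\mathfrak f)$ by a finite (possibly empty) chain of one step reductions. Pseudo-Gröbner basis: $\operatorname{Lt}(g,\mathfrak g)=\mathfrak g[x]\operatorname{lt}(g)$, $\operatorname{Lt}(G)=\sum_i\operatorname{Lt}(g_i,\mathfrak g_i)$, and for an ideal $I$ of $R[x]$, $\operatorname{Lt}(I)$ is the ideal generated by the leading terms of the non-zero elements of $I$. A finite set $G$ of non-zero pseudo-polynomials with $\langle G\rangle\subseteq I$ is a pseudo-Gröbner basis of $I$ if $\operatorname{Lt}(I)=\operatorname{Lt}(G)$. S-polynomial: for non-zero pseudo-polynomials $(f,\mathfrak f)$, $(g,\mathfrak g)$ and $m=\operatorname{lcm}(\operatorname{lm}(f),\operatorname{lm}(g))$, $$\operatorname{spoly}((f,\mathfrak f),(g,\mathfrak g))=\Bigl(\tfrac{m}{\operatorname{lm}(f)}\tfrac1{\operatorname{lc}(f)}f-\tfrac{m}{\operatorname{lm}(g)}\tfrac1{\operatorname{lc}(g)}g,\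 \operatorname{lc}(f)\mathfrak f\cap\operatorname{lc}(g)\mathfrak g\Bigr).$$ *)

(* Defs.v *)
From HB Require Import structures.
From mathcomp Require Import all_boot all_order all_algebra.
From mathcomp Require Import boolp classical_sets wochoice.
From mathcomp Require Import mpoly.
From Stdlib Require Import Relation_Operators.

Set Implicit Arguments.
Unset Strict Implicit.
Unset Printing Implicit Defensive.

Import GRing.Theory.
Local Open Scope ring_scope.
Local Open Scope classical_set_scope.

(* The finite sums of products a * b with a in A and b in B. *)
Definition combos (V : pzRingType) (A B : set V) : set V :=
  [set x | exists s : seq (V * V),
     (forall z, z \in s -> A z.1 /\ B z.2) /\ x = \sum_(z <- s) z.1 * z.2].

Definition sumset (V : nmodType) (I : finType) (P : pred I) (A : I -> set V) :
    set V :=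
  [set x | exists y : I -> V,
     (forall i, P i -> A i (y i)) /\ x = \sum_(i | P i) y i].

Section Dedekind.
Variable R : idomainType.

Definition is_ideal (I : set R) : Prop :=
  [/\ I 0, forall a b, I a -> I b -> I (a + b) & forall r a, I a -> I (r * a)].

Definition is_prime_ideal (P : set R) : Prop :=
  [/\ is_ideal P, ~ P 1 & forall a b, P (a * b) -> P a \/ P b].

Definition noetherian : Prop :=
  forall I : set R, is_ideal I ->
    exists s : seq R, I = combos [set: R] [set` s].

Definition integrally_closed : Prop :=
  forall z : {fraction R}, integralOver (@tofrac R) z -> exists a : R, z = tofrac a.

Definition prime_chain (d : nat) (P : nat -> set R) : Prop :=
  (forall i, (i <= d)%N -> is_prime_ideal (P i)) /\
  (forall i, (i < d)%N -> P i `<` P i.+1).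

Definition has_krull_dim (d : nat) : Prop :=
  (exists P, prime_chain d P) /\ (forall k P, prime_chain k P -> (k <= d)%N).

Definition dedekind_domain : Prop :=
  [/\ noetherian, integrally_closed & has_krull_dim 1].

End Dedekind.

Section Fractional.
Variable R : idomainType.
Local Notation K := {fraction R}.

Definition Rfrac : set K := range (@tofrac R).

Definition fractional_ideal (A : set K) : Prop :=
  (exists s : seq K, A = combos Rfrac [set` s]) /\
  (exists2 a, A a & a != 0).

Definition fid_inv (A : set K) : set K :=
  [set x | forall a, A a -> Rfrac (x * a)].

End Fractional.

Definition monomial_order (n : nat) (le : rel 'X_{1..n}) : Prop :=
  [/\ total_order le, well_order le &
    forall m1 m2 m : 'X_{1..n}, le m1 m2 -> le (m1 + m)%MM (m2 + m)%MM].

Section Pseudo.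
Variables (R : idomainType) (n : nat) (le : rel 'X_{1..n}).
Local Notation K := {fraction R}.
Local Notation Kx := {mpoly K[n]}.

(* 1 = x^0 is the smallest monomial of a monomial ordering, so for f != 0 the
   neutral element of this maximum plays no role; mdeg_lead 0 is junk. *)
Definition mdeg_lead (f : Kx) : 'X_{1..n} :=
  \big[(fun m1 m2 => if le m1 m2 then m2 else m1)/0%MM]_(m <- msupp f) m.

Definition lc (f : Kx) : K := f@_(mdeg_lead f).
Definition lm (f : Kx) : Kx := 'X_[mdeg_lead f].
Definition lt (f : Kx) : Kx := lc f *: lm f.

Definition polys_in (A : set K) : set Kx := [set f | forall m, A f@_m].

(* The candidate pairs (f, A); is_pseudo singles out the pseudo-polynomials. *)
Definition pseudo : Type := (Kx * set K)%type.
HB.instance Definition _ := Choice.copy pseudo (Kx * set K)%type.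
Implicit Types (p q h : pseudo) (G : seq pseudo).

Definition is_pseudo p : Prop :=
  fractional_ideal p.2 /\ (forall a, p.2 a -> polys_in (@Rfrac R) (a *: p.1)).

Definition lc_ideal p : set K := [set a * lc p.1 | a in p.2].

Definition tuple_of G (i : 'I_(size G)) : pseudo := tnth (in_tuple G) i.

Definition gen G : set Kx :=
  sumset xpredT (fun i : 'I_(size G) =>
    [set c * (tuple_of i).1 | c in polys_in (tuple_of i).2]).

Definition Lt_fam G : set Kx :=
  sumset xpredT (fun i : 'I_(size G) =>
    [set c * lt (tuple_of i).1 | c in polys_in (tuple_of i).2]).

Definition Lt_ideal (I : set Kx) : set Kx :=
  combos (polys_in (@Rfrac R)) [set lt f | f in [set f | I f /\ f != 0]].

Definition pseudo_groebner_basis G (I : set Kx) : Prop :=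
  [/\ forall p, p \in G -> is_pseudo p /\ p.1 != 0,
      gen G `<=` I & Lt_ideal I = Lt_fam G].

Definition lm_divides G (f : Kx) : pred 'I_(size G) :=
  fun i => (mdeg_lead (tuple_of i).1 <= mdeg_lead f)%MM.

Definition can_be_reduced G p : Prop :=
  lc_ideal p `<=` sumset (@lm_divides G p.1)
                    (fun i : 'I_(size G) => lc_ideal (tuple_of i)).

Definition is_minimal G p : Prop := p.1 != 0 /\ ~ can_be_reduced G p.

Definition one_step_reduction G p q : Prop :=
  p.1 != 0 /\
  exists a : 'I_(size G) -> K,
    [/\ forall i, lm_divides p.1 i ->
          combos (tuple_of i).2 (fid_inv p.2) (a i),
        lc p.1 = \sum_(i | lm_divides p.1 i) a i * lc (tuple_of i).1 &
        q = (p.1 - \sum_(i | lm_divides p.1 i)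
               a i *: ('X_[mdeg_lead p.1 - mdeg_lead (tuple_of i).1]
                       * (tuple_of i).1), p.2)].

Definition reduces_to G : pseudo -> pseudo -> Prop :=
  clos_refl_trans pseudo (one_step_reduction G).

Definition spoly p q : pseudo :=
  let m := mlcm (mdeg_lead p.1) (mdeg_lead q.1) in
  ('X_[m - mdeg_lead p.1] * ((lc p.1)^-1 *: p.1)
   - 'X_[m - mdeg_lead q.1] * ((lc q.1)^-1 *: q.1),
   lc_ideal p `&` lc_ideal q).

(* N is an ideal of R, seen inside K as its image. *)
Definition ideal_in_frac (N : set R) : set K := @tofrac R @` N.

Definition coef_replacement (N : set R) h h' : Prop :=
  exists (g1 g2 : Kx) (A1 : set K),
    [/\ is_pseudo (g1, A1), g1 != 0,
        [set a *: g1 | a in A1] = [set a *: h.1 | a in h.2],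
        {subset msupp g2 <= msupp g1} /\
        (forall m, m \in msupp g1 ->
           combos (ideal_in_frac N) (fid_inv A1) (g1@_m - g2@_m)) &
        h' = (g2, A1)].

(* The pairs still to be treated, and the current family. *)
Definition state : Type := (set (pseudo * pseudo) * seq pseudo)%type.

(* T consists of the pairs of distinct members of F.  Such a pair may be
   recorded in either orientation, or in both. *)
Definition initial_pairs (F : seq pseudo) (T : set (pseudo * pseudo)) : Prop :=
  (forall p q, T (p, q) -> [/\ p \in F, q \in F & p <> q]) /\
  (forall p q, p \in F -> q \in F -> p <> q -> T (p, q) \/ T (q, p)).

(* One execution of the body of the loop. *)
Definition step (N : set R) (s s' : state) : Prop :=
  let: (T, G) := s in
  exists (p q h0 h : pseudo),
    [/\ T (p, q),
        reduces_to G (spoly p q) h0,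
        h0.1 = 0 \/ is_minimal G h0,
        (if h0.1 == 0 then h = h0 else coef_replacement N h0 h) &
        s' = (if h.1 == 0 then (T `\ (p, q), G)
              else ((T `\ (p, q)) `|` [set (f, h) | f in [set` G]],
                    rcons G h))].

Definition runs_to (N : set R) : state -> state -> Prop :=
  clos_refl_trans state (step N).

End Pseudo.

(* Main.v *)
(** Termination: every member added to G has a leading coefficient ideal not
    contained in the sum of those of the earlier members whose leading monomial
    divides its own; by Dickson's lemma an infinite run would give a strictly
    increasing chain of ideals of R.  Between two additions only pairs are
    removed.

    Correctness: this is Buchberger's argument.  The one arithmetic ingredient is
    that in a Dedekind domain a sum D of ideals A_i is invertible, so that
    1 = sum_i u_i with u_i D <= A_i; hence the syzygies of the leading terms are
    generated by those of pairs, that is, by the S-polynomials.  Reducing the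
    coefficients modulo N changes a remainder only by multiples of (1, N), of no
    larger degree, and minimality of the remainder prevents its leading
    coefficient from being cancelled. *)

Require Import Defs.
From mathcomp Require Import all_boot all_order all_algebra.
From mathcomp Require Import boolp classical_sets wochoice.
From mathcomp Require Import mpoly.
From Stdlib Require Import Relation_Operators.
Import GRing.Theory.
Local Open Scope ring_scope.
Local Open Scope classical_set_scope.

Set Implicit Arguments.
Unset Strict Implicit.
Unset Printing Implicit Defensive.

(** * Invertibility of ideals in Dedekind domains *)

Section Noetherian.
Variable R : idomainType.
Implicit Types (I J P : set R) (a b r : R).

(** The condition carried through the loop is not that S-polynomials reduce to zero, but the weaker
    one that every admissible multiple of an S-polynomial is a combination of members of G with all
    leading exponents below the lcm. It survives enlarging G and, unlike a chain of reductions, it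
    tolerates a remainder whose lower terms have been perturbed.

    The perturbation is controlled by the leading exponent 0 of (1, N): this exponent divides every
    other, so N lies in each sum D of leading coefficient ideals against which a remainder is
    tested. Old and new leading coefficients, multiplied by the ideal part, differ by elements of N,
    so they lie in D together or not at all. As 0 lies in D, the new one cannot vanish.

    Invertibility of ideals serves a second purpose: it turns a mere containment of leading
    coefficient ideals into the coefficients of an actual reduction step. *)

Lemma combos_ideal_sub I (B : set R) : is_ideal I -> B `<=` I -> combos [set: R] B `<=` I.
Proof.
move=> [I0 ID IM] BI x [s [sP ->]]; rewrite big_seq.
by apply: (big_ind I) => // z /sP[_ /BI]; apply: IM.
Qed.

Lemma mem_combos_setT (B : set R) b : B b -> combos [set: R] B b.
Proof.
by move=> Bb; exists [:: (1, b)]; split=> [z|]; rewrite ?inE ?big_seq1 ?mul1r // => /eqP->.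
Qed.

Lemma noetherian_chain (I : nat -> set R) : noetherian R ->
    (forall k, is_ideal (I k)) -> (forall k, I k `<=` I k.+1) ->
  exists k, forall j, I j `<=` I k.
Proof.
move=> nR idI incI.
have mono i j : (i <= j)%N -> I i `<=` I j.
  move=> /subnK <-; elim: (j - i)%N => [|d IH] //= x /IH; exact: incI.
pose U := [set x | exists k, I k x].
have idU : is_ideal U.
  split; first by exists 0%N; case: (idI 0%N).
  - move=> a b [i Ia] [j Ib]; exists (maxn i j); have [_ + _] := idI (maxn i j).
    by apply; [apply: mono Ia; rewrite leq_maxl|apply: mono Ib; rewrite leq_maxr].
  - by move=> r a [i Ia]; exists i; have [_ _] := idI i; apply.
have [s Us] := nR U idU.
have [k sk] : exists k, [set` s] `<=` I k.
  have : [set` s] `<=` U by move=> x xs; rewrite Us; apply: mem_combos_setT.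
  elim: s {Us} => [|x s IH] sU; first by exists 0%N => x.
  have [|k sk] := IH; first by move=> y ys; apply: sU; rewrite /= inE ys orbT.
  have [|j xj] := sU x; first by rewrite /= inE eqxx.
  exists (maxn k j) => y; rewrite /= inE => /orP[/eqP->|/sk].
    by apply: mono xj; rewrite leq_maxr.
  by apply: mono; rewrite leq_maxl.
exists k => j x Ix; have : U x by exists j.
by rewrite Us; apply: combos_ideal_sub.
Qed.

(** Without a maximal member, choice produces a strictly increasing sequence in C, against
    [noetherian_chain]. *)
Lemma noetherian_max (C : set (set R)) I0 : noetherian R ->
    (forall I, C I -> is_ideal I) -> C I0 ->
  exists I, C I /\ forall J, C J -> I `<=` J -> J = I.
Proof.
move=> nR idC CI0; apply: contrapT => nomax.
have next (X : {I | C I}) : exists Y : {I | C I}, sval X `<` sval Y.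
  case: X => I CI; apply: contrapT => noY; apply: nomax; exists I; split=> // J CJ IJ.
  apply: contrapT => neq; apply: noY; exists (exist _ J CJ); split=> //= JI.
  by apply: neq; apply/seteqP.
have [f fP] := choice next.
pose X := fix X k := if k is k'.+1 then f (X k') else exist _ I0 CI0.
have [||k kP] := @noetherian_chain (fun k => sval (X k)) nR.
- by move=> k; apply: idC; apply: (svalP (X k)).
- by move=> k; case: (fP (X k)).
- by case: (fP (X k)) => _; apply; apply: (kP k.+1).
Qed.

(** An ideal maximal among the proper ideals containing I is prime. *)
Lemma proper_ideal_prime I : noetherian R -> is_ideal I -> ~ I 1 ->
  exists P, is_prime_ideal P /\ I `<=` P.
Proof.
move=> nR idI I1.
have [P [[idP P1 IP] maxP]] := @noetherian_max
  [set J | [/\ is_ideal J, ~ J 1 & I `<=` J]] I nR (fun _ '(And3 h _ _) => h)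
  (And3 idI I1 (@subset_refl _ I)).
exists P; split=> //; have [P0 PD PM] := idP; split=> // a b Pab.
apply: contrapT => /not_orP[Pa Pb].
(* Q is P + Ra. If 1 = p + ra then b = bp + rab lies in P; otherwise Q is proper, hence equal to P,
   and a lies in P. *)
pose Q := [set x | exists2 p, P p & exists r, x = p + r * a].
have idQ : is_ideal Q.
  split; first by exists 0 => //; exists 0; rewrite mul0r addr0.
  - move=> x y [p Pp [r ->]] [q Pq [t ->]]; exists (p + q); first exact: PD.
    by exists (r + t); rewrite mulrDl addrACA.
  - move=> c x [p Pp [r ->]]; exists (c * p); first exact: PM.
    by exists (c * r); rewrite mulrDr mulrA.
have PQ : P `<=` Q by move=> p Pp; exists p => //; exists 0; rewrite mul0r addr0.
have [Q1|Q1] := pselect (Q 1).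
  case: Q1 => p Pp [r e]; apply: Pb; rewrite -[b]mulr1 e mulrDr.
  by apply: PD; [apply: PM|rewrite mulrCA [b * a]mulrC; apply: PM].
have QP : Q = P by apply: maxP => //; split=> //; apply: subset_trans PQ.
by apply: Pa; rewrite -QP; exists 0 => //; exists 1; rewrite mul1r add0r.
Qed.

(** A strict inclusion would give the chain 0 < P < Q of length 2. *)
Lemma prime_maximal (P Q : set R) : has_krull_dim R 1 -> is_prime_ideal P ->
  is_prime_ideal Q -> (exists2 a, P a & a != 0) -> P `<=` Q -> P = Q.
Proof.
move=> [_ dim1] pP pQ [a Pa a0] PQ; apply: contrapT => neq.
pose c k := if k is k'.+1 then if k' is 0 then P else Q else [set 0 : R].
suff /dim1 : prime_chain 2 c by [].
split.
  move=> [|[|k]] //= _; split; last by move=> x y /eqP; rewrite mulf_eq0 => /orP[]/eqP; [left|right].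
    by split=> // [x y -> ->|r x ->]; rewrite ?addr0 ?mulr0.
  by apply/eqP; rewrite oner_eq0.
move=> [|[|k]] //= _; split=> //.
- by move=> x ->; case: pP => [[]].
- by move=> /(_ a Pa) /= e; rewrite e eqxx in a0.
- by move=> QP; apply: neq; apply/seteqP.
Qed.

(* P is an associated prime of R/(a): localise (a) at P, take a maximal
   annihilator of the quotient, and clear the finitely many denominators. *)
Lemma ideal_transporter J a : noetherian R -> has_krull_dim R 1 ->
    is_ideal J -> ~ J 1 -> J a -> a != 0 ->
  exists b, ~ (exists r, b = r * a) /\ forall x, J x -> exists r, b * x = r * a.
Proof.
move=> nR dim1 idJ J1 Ja a0.
have [P [pP JP]] := proper_ideal_prime nR idJ J1.
have [[P0 PD PM] P1 Pprime] := pP.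
have Pa := JP _ Ja.
(* Q is the contraction to R of the ideal generated by a in the localisation at P. *)
pose Q := [set x | exists s, ~ P s /\ exists r, s * x = r * a].
have PsM s t : ~ P s -> ~ P t -> ~ P (s * t) by move=> Ps Pt /Pprime[].
have idQ : is_ideal Q.
  split; first by exists 1; split=> //; exists 0; rewrite mulr0 mul0r.
  - move=> x y [s [Ps [r e]]] [t [Pt [u e']]]; exists (s * t); split; first exact: PsM.
    exists (t * r + s * u); rewrite mulrDr mulrDl -!mulrA -e -e'.
    by congr (_ + _); rewrite mulrCA.
  - move=> r x [s [Ps [u e]]]; exists s; split=> //; exists (r * u).
    by rewrite mulrCA e mulrA.
pose ann c := [set x | Q (x * c)].
have idann c : is_ideal (ann c).
  have [Q0 QD QM] := idQ.
  split; rewrite /ann /=; first by rewrite mul0r.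
  - by move=> x y Qx Qy; rewrite mulrDl; apply: QD.
  - by move=> r x Qx; rewrite -mulrA; apply: QM.
have Q1 : ~ Q 1 by move=> [s [Ps [r]]]; rewrite mulr1 => e; apply: Ps; rewrite e; apply: PM.
have [_ [[c Qc ->] maxc]] := @noetherian_max [set X | exists2 c, ~ Q c & X = ann c] (ann 1)
  nR (fun _ '(ex_intro2 c _ e) => ecast z (is_ideal z) (esym e) (idann c)) 
  (ex_intro2 _ _ 1 Q1 erefl).
(* If xy annihilates c and yc is not in Q, then ann (yc) contains ann c, hence equals it by
   maximality, and x annihilates yc. *)
have pann : is_prime_ideal (ann c).
  split=> //; first by rewrite /ann /= mul1r.
  move=> x y Qxy; have [Qyc|Qyc] := pselect (Q (y * c)); [by right|left].
  rewrite -(maxc (ann (y * c))); first by rewrite /ann /= mulrA.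
    by exists (y * c).
  by move=> z Qz; rewrite /ann /= mulrCA; case: idQ => _ _; apply.
have annP : ann c `<=` P.
  move=> x [s [Ps [r e]]]; apply: contrapT => Px; apply: Qc.
  by exists (s * x); split; [apply: PsM|exists r; rewrite -mulrA].
(* Dimension one applies because ann c contains the non-zero a. *)
have /esym eP : ann c = P.
  apply: prime_maximal => //; exists a => //.
  by exists 1; split=> //; exists c; rewrite mul1r mulrC.
have [s sP] := nR P (And3 P0 PD PM).
have sQ x : x \in s -> Q (x * c).
  move=> xs; have : P x by rewrite sP; apply: mem_combos_setT.
  by rewrite eP.
(* The product t of the denominators of the finitely many generators of P satisfies tcP <= Ra, and b
   = tc is not in Ra because c is not in Q. *)
have [t [Pt tP]] : exists t, ~ P t /\ forall x, x \in s -> exists r, t * c * x = r * a.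
  elim: s {sP} sQ => [|x s IH] sQ; first by exists 1; split.
  have [y ys|t [Pt tP]] := IH; first by apply: sQ; rewrite inE ys orbT.
  have [|u [Pu [r e]]] := sQ x; first by rewrite inE eqxx.
  exists (u * t); split; first exact: PsM.
  move=> y; rewrite inE => /orP[/eqP->|/tP [r' e']].
    by exists (t * r); rewrite -[RHS]mulrA -e [u * t]mulrC -!mulrA [x * c]mulrC.
  by exists (u * r'); rewrite -[RHS]mulrA -e' !mulrA.
exists (t * c); split.
  by move=> [r e]; apply: Qc; exists t; split=> //; exists r.
move=> x /JP; rewrite sP => -[l [lP ->]].
rewrite mulr_sumr big_seq; elim/big_rec: _ => [|z y zl [r ->]]; first by exists 0; rewrite mul0r.
have [_ /tP[u e]] := lP _ zl.
by exists (z.1 * u + r); rewrite mulrDl mulrCA e mulrA.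
Qed.

End Noetherian.

(** * Submodules of the fraction field and their inverses *)

Section Invertible.
Variable R : idomainType.
Local Notation K := {fraction R}.
Local Notation Rf := (@Rfrac R).
Implicit Types (A B M : set K) (x y a b : K).

(** Finite generation is left out, so that sums, intersections and inverses need no generators;
    [submodule_fg] recovers it from noetherianity. *)
Definition is_submodule A : Prop :=
  [/\ A 0, forall x y, A x -> A y -> A (x + y) & forall r x, Rf r -> A x -> A (r * x)].

Lemma Rfrac1 : Rf 1. Proof. by exists 1; rewrite ?tofrac1. Qed.

Lemma RfracM x y : Rf x -> Rf y -> Rf (x * y).
Proof. by move=> [a _ <-] [b _ <-]; exists (a * b); rewrite ?tofracM. Qed.

Lemma RfracN x : Rf x -> Rf (- x).
Proof. by move=> [a _ <-]; exists (- a); rewrite ?tofracN. Qed.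

Lemma submodule_Rfrac : is_submodule Rf.
Proof.
split; first by exists 0; rewrite ?tofrac0.
- by move=> _ _ [a _ <-] [b _ <-]; exists (a + b); rewrite ?tofracD.
- exact: RfracM.
Qed.

Lemma submodule_sum A (I : Type) (r : seq I) (P : pred I) (F : I -> K) :
  is_submodule A -> (forall i, P i -> A (F i)) -> A (\sum_(i <- r | P i) F i).
Proof. by move=> [A0 AD _] AF; apply: (big_ind A). Qed.

Lemma submodule_sum_seq A (I : eqType) (r : seq I) (F : I -> K) :
  is_submodule A -> (forall i, i \in r -> A (F i)) -> A (\sum_(i <- r) F i).
Proof. by move=> sA AF; rewrite big_seq; apply: submodule_sum. Qed.

Lemma submoduleN A x : is_submodule A -> A x -> A (- x).
Proof. by move=> [_ _ AM] Ax; rewrite -mulN1r; apply: AM => //; apply/RfracN/Rfrac1. Qed.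

Lemma combos_mem (V : pzRingType) (A B : set V) (a b : V) : A a -> B b -> combos A B (a * b).
Proof.
move=> Aa Bb; exists [:: (a, b)]; rewrite big_seq1; split=> // z.
by rewrite inE => /eqP->.
Qed.

Lemma combosD (V : pzRingType) (A B : set V) (x y : V) :
  combos A B x -> combos A B y -> combos A B (x + y).
Proof.
move=> [s [sP ->]] [t [tP ->]]; exists (s ++ t); rewrite big_cat; split=> // z.
by rewrite mem_cat => /orP[/sP|/tP].
Qed.

Lemma combos0 (V : pzRingType) (A B : set V) : combos A B 0.
Proof. by exists [::]; rewrite big_nil. Qed.

Lemma combos_sub A B M : is_submodule M ->
  (forall a b, A a -> B b -> M (a * b)) -> combos A B `<=` M.
Proof.
move=> sM ABM x [s [sP ->]]; apply: submodule_sum_seq => // z /sP[Az Bz].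
exact: ABM.
Qed.

Lemma submodule_combos A B : is_submodule A -> is_submodule (combos A B).
Proof.
move=> [A0 AD AM]; split; [exact: combos0|exact: combosD|].
move=> r x Rr [s [sP ->]]; exists [seq (r * z.1, z.2) | z <- s]; split.
  by move=> _ /mapP[z /sP[Az Bz] ->] /=; split=> //; apply: AM.
by rewrite big_map mulr_sumr; apply: eq_bigr => z _ /=; rewrite mulrA.
Qed.

Lemma submodule_setI A B : is_submodule A -> is_submodule B -> is_submodule (A `&` B).
Proof.
move=> [A0 AD AM] [B0 BD BM]; split=> //.
  by move=> x y [Ax Bx] [Ay By]; split; [apply: AD|apply: BD].
by move=> r x Rr [Ax Bx]; split; [apply: AM|apply: BM].
Qed.

Lemma submodule_fid_inv A : is_submodule (fid_inv A).
Proof.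
have [R0 RD RM] := submodule_Rfrac.
split; first by move=> a _; rewrite mul0r.
  by move=> x y Ax Ay a Aa; rewrite mulrDl; apply: RD; [apply: Ax|apply: Ay].
by move=> r x Rr Ax a Aa; rewrite -mulrA; apply: RM => //; apply: Ax.
Qed.

Lemma submodule_scale A c : is_submodule A -> is_submodule [set a * c | a in A].
Proof.
move=> [A0 AD AM]; split; first by exists 0; rewrite ?mul0r.
  by move=> _ _ [x Ax <-] [y Ay <-]; exists (x + y); rewrite ?mulrDl //; apply: AD.
by move=> r _ Rr [x Ax <-]; exists (r * x); rewrite ?mulrA //; apply: AM.
Qed.

Lemma submodule_sumset (I : finType) (P : pred I) (A : I -> set K) :
  (forall i, P i -> is_submodule (A i)) -> is_submodule (sumset P A).
Proof.
move=> sA; split.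
- by exists (fun=> 0); split; [move=> i /sA[]|rewrite big1].
- move=> _ _ [y [yA ->]] [z [zA ->]]; exists (fun i => y i + z i).
  by rewrite big_split; split=> // i Pi; have [_ + _] := sA i Pi; apply; auto.
- move=> r _ Rr [y [yA ->]]; exists (fun i => r * y i).
  by rewrite mulr_sumr; split=> // i Pi; have [_ _ +] := sA i Pi; apply; auto.
Qed.

Lemma sumset_mem (I : finType) (P : pred I) (A : I -> set K) i x :
  (forall j, P j -> is_submodule (A j)) -> P i -> A i x -> sumset P A x.
Proof.
move=> sA Pi Aix; exists (fun j => if j == i then x else 0); split.
  by move=> j Pj; case: eqP => [->//|_]; case: (sA j Pj).
by rewrite -big_mkcondr (big_pred1 i) // => j /=; case: eqP => [->|]; rewrite ?andbF ?Pi.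
Qed.

Lemma sumset_sub (I : finType) (P : pred I) (A : I -> set K) B :
  is_submodule B -> (forall i, P i -> A i `<=` B) -> sumset P A `<=` B.
Proof. by move=> sB AB _ [y [yA ->]]; apply: submodule_sum => // i Pi; apply: (AB i); auto. Qed.

Definition trace_ideal A : set R := [set r | A (tofrac r)].

Lemma is_ideal_trace A : is_submodule A -> is_ideal (trace_ideal A).
Proof.
move=> [A0 AD AM]; split; rewrite /trace_ideal /= ?tofrac0 //.
  by move=> a b Aa Ab; rewrite tofracD; apply: AD.
by move=> r a Aa; rewrite tofracM; apply: AM => //; exists r.
Qed.

Lemma submodule_ideal (N : set R) : is_ideal N -> is_submodule (ideal_in_frac N).
Proof.
move=> [N0 ND NM]; split; first by exists 0; rewrite ?tofrac0.
  by move=> _ _ [a Na <-] [b Nb <-]; exists (a + b); rewrite ?tofracD //; apply: ND.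
by move=> _ _ [r _ <-] [b Nb <-]; exists (r * b); rewrite ?tofracM //; apply: NM.
Qed.

Lemma fractional_submodule A : fractional_ideal A -> is_submodule A.
Proof. by move=> [[s ->] _]; apply/submodule_combos/submodule_Rfrac. Qed.

(** Multiplication by the common denominator d identifies A with an ideal of R. *)
Lemma submodule_fg A d : noetherian R -> is_submodule A -> d != 0 ->
  fid_inv A d -> exists s : seq K, A = combos Rf [set` s].
Proof.
move=> nR sA d0 dA.
have [s sP] := nR _ (is_ideal_trace (submodule_scale d sA)).
exists [seq tofrac r / d | r <- s]; apply/seteqP; split=> x.
  move=> Ax; have [r _ e] := dA _ Ax.
  have : trace_ideal [set a * d | a in A] r by exists x => //; rewrite e mulrC.
  rewrite sP => -[t [tP er]]; exists [seq (tofrac z.1, tofrac z.2 / d) | z <- t]; split.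
    move=> _ /mapP[z zt ->]; have [_ /= zs] := tP _ zt; split; first by exists z.1.
    by apply/mapP; exists z.2.
  rewrite big_map /=; apply: (mulfI d0); rewrite -e er rmorph_sum mulr_sumr.
  by apply: eq_bigr => z _; rewrite rmorphM mulrCA [d * _]mulrC divfK.
apply: combos_sub => // a _ Ra /mapP[r rs ->]; case: sA => _ _; apply => //.
have : trace_ideal [set a * d | a in A] r by rewrite sP; apply: mem_combos_setT.
by move=> [y Ay <-]; rewrite mulfK.
Qed.

Lemma fractionalP A d : noetherian R -> is_submodule A -> d != 0 ->
  fid_inv A d -> (exists2 a, A a & a != 0) -> fractional_ideal A.
Proof. by move=> nR sA d0 dA A0; split=> //; apply: submodule_fg dA. Qed.

(** Determinant trick: x acts on the generators by a matrix over R, so it is a root of the monic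
    characteristic polynomial; the vector of generators is non-zero because M is. *)
Lemma stable_integral M x : (exists s : seq K, M = combos Rf [set` s]) ->
    (exists2 a, M a & a != 0) -> (forall a, M a -> M (x * a)) ->
  integralOver (@tofrac R) x.
Proof.
move=> [s Ms] [a Ma a0] xM.
have expand y : M y -> exists c : 'I_(size s) -> R, y = \sum_i tofrac (c i) * s`_i.
  rewrite Ms => -[t [tP ->]].
  rewrite big_seq; elim/big_rec: _ => [|z w /tP[[r _ e] zs] [c ->]].
    by exists (fun=> 0); rewrite big1 // => i _; rewrite tofrac0 mul0r.
  have zi : (index z.2 s < size s)%N by rewrite index_mem.
  exists (fun i => (if i == Ordinal zi then r else 0) + c i).
  under [RHS]eq_bigr do rewrite tofracD mulrDl.
  rewrite big_split /=; congr (_ + _).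
  rewrite (bigD1 (Ordinal zi)) //= eqxx nth_index // e big1 ?addr0 //.
  by move=> i /negPf->; rewrite tofrac0 mul0r.
have /choice[C CP] : forall i : 'I_(size s), exists c : 'I_(size s) -> R,
    x * s`_i = \sum_j tofrac (c j) * s`_j.
  move=> i; apply: expand; apply: xM; rewrite Ms -[s`_i]mul1r.
  by apply: combos_mem; [exact: Rfrac1|apply: mem_nth].
(* Transposed, since eigenvectors here are rows multiplying the matrix from the left. *)
pose A := \matrix_(i, j) C j i; exists (char_poly A); first exact: char_poly_monic.
rewrite map_char_poly -eigenvalue_root_char.
apply/eigenvalueP; exists (\row_i s`_i).
  apply/rowP => i; rewrite !mxE mulrC mulrC CP; apply: eq_bigr => j _.
  by rewrite !mxE mulrC.
apply: contraNneq a0 => e; have [c ->] := expand _ Ma; apply/eqP; rewrite big1 // => i _.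
by move/rowP/(_ i): e; rewrite !mxE => ->; rewrite mulr0.
Qed.

Lemma fid_inv_id A a x : fid_inv A x -> A a -> Rf (a * x).
Proof. by move=> xA Aa; rewrite mulrC; apply: xA. Qed.

(* If A A^-1 were a proper ideal J, then J^-1 would contain some x outside R;
   but x A^-1 <= A^-1, so x is integral over R. *)
Lemma dedekind_invertible A d : dedekind_domain R -> is_submodule A ->
    (exists2 a, A a & a != 0) -> d != 0 -> fid_inv A d ->
  combos A (fid_inv A) 1.
Proof.
move=> [nR iR dim1] sA [a Aa a0] d0 dA; apply: contrapT => AA1.
pose J := combos A (fid_inv A).
have sJ : is_submodule J by apply: submodule_combos.
have JR : J `<=` Rf.
  by apply: combos_sub; [exact: submodule_Rfrac|move=> x y Ax yA; apply: fid_inv_id yA Ax].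
have Jad : J (a * d) by apply: combos_mem.
have [c _ ec] := JR _ Jad.
have c0 : c != 0 by rewrite -(@tofrac_eq0 R) ec mulf_neq0.
have [|||b [bc bJ]] := @ideal_transporter R (trace_ideal J) c nR dim1 (is_ideal_trace sJ).
- by rewrite /trace_ideal /= tofrac1.
- by rewrite /trace_ideal /= ec.
- exact: c0.
have tc0 : tofrac c != 0 :> K by rewrite tofrac_eq0.
(* Here x = b / c satisfies xJ <= R. For y in A^-1 and a in A this gives (xy)a = x(ya) in R, so x
   stabilises A^-1; but b is not a multiple of c. *)
have [] : exists r : R, tofrac b / tofrac c = tofrac r.
  apply: iR; apply: (@stable_integral (fid_inv A)).
  - apply: (@submodule_fg _ a) => //; first exact: submodule_fid_inv.
    by move=> x xA; apply: fid_inv_id xA Aa.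
  - by exists d.
  - move=> x xA y Ay; rewrite -mulrA.
    have Jxy : J (x * y) by rewrite mulrC; apply: combos_mem.
    have [r _ er] := JR _ Jxy; have [|u eu] := bJ r; first by rewrite /trace_ideal /= er.
    by exists u; rewrite // -er mulrAC -tofracM eu tofracM mulfK.
move=> r e; apply: bc; exists r; apply/eqP; rewrite -(@tofrac_eq R) tofracM -e.
by rewrite divfK.
Qed.

Lemma dedekind_partition (I : finType) (P : pred I) (A : I -> set K) :
    dedekind_domain R -> (forall i, P i -> is_submodule (A i)) ->
    (forall i, P i -> A i `<=` Rf) -> (exists2 a, sumset P A a & a != 0) ->
  exists u : I -> K, [/\ \sum_(i | P i) u i = 1, forall i, P i -> Rf (u i) &
    forall i d, P i -> sumset P A d -> A i (u i * d)].
Proof.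
move=> dR sA AR D0.
have sD := submodule_sumset sA.
have DR : sumset P A `<=` Rf by apply: sumset_sub => //; exact: submodule_Rfrac.
have [|s [sP e1]] := dedekind_invertible dR sD D0 (oner_neq0 _).
  by move=> x /DR; rewrite mul1r.
have /choice[y yP] : forall z : K * K, exists y : I -> K, z \in s ->
    (forall i, P i -> A i (y i)) /\ z.1 = \sum_(i | P i) y i.
  by move=> z; have [/sP[[y yP] _]|zs] := boolP (z \in s); [exists y|exists (fun=> 0)].
(* Write 1 as a sum of z.1 * z.2 with z.1 in D and z.2 in D^-1, and split each z.1 into components y
   z i in A_i. Since z.2 * d lies in R for d in D, u_i D is contained in A_i. *)
exists (fun i => \sum_(z <- s) y z i * z.2); split.
- rewrite exchange_big /= e1 big_seq [RHS]big_seq; apply: eq_bigr => z /yP[_ ->].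
  by rewrite mulr_suml.
- move=> i Pi; apply: submodule_sum_seq => [|z zs]; first exact: submodule_Rfrac.
  have [_ zD] := sP _ zs; rewrite mulrC; apply: zD.
  by apply: (sumset_mem sA Pi); have [+ _] := yP z zs; apply.
- move=> i d Pi Dd; rewrite mulr_suml; apply: submodule_sum_seq => [|z zs]; first exact: sA.
  have [_ zD] := sP _ zs; rewrite -mulrA mulrC; have [_ _] := sA i Pi; apply; first exact: zD.
  by have [+ _] := yP z zs; apply.
Qed.

End Invertible.

(** * Monomial orders and Dickson's lemma *)

Section MonomialOrder.
Variables (n : nat) (le : rel 'X_{1..n}).
Implicit Types m : 'X_{1..n}.

Definition mon_lt m1 m2 := le m1 m2 && (m1 != m2).

Lemma mon_le_refl : monomial_order le -> reflexive le.
Proof. by case=> [[[[]]]]. Qed.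

Lemma mon_le_trans : monomial_order le -> transitive le.
Proof. by case=> [[[[]]]]. Qed.

Lemma mon_le_anti : monomial_order le -> antisymmetric le.
Proof. by case=> [[[]]]. Qed.

Lemma mon_le_total : monomial_order le -> total le.
Proof. by case=> [[]]. Qed.

Lemma mon_le_add : monomial_order le -> forall m1 m2 m, le m1 m2 -> le (m1 + m)%MM (m2 + m)%MM.
Proof. by case. Qed.

Lemma mon_le_lt_trans m1 m2 m3 : monomial_order le ->
  le m1 m2 -> mon_lt m2 m3 -> mon_lt m1 m3.
Proof.
move=> ole l12 /andP[l23 n23]; apply/andP; split; first exact: mon_le_trans l12 l23.
apply: contraNneq n23 => e; rewrite -e in l23 *.
by apply/eqP/(mon_le_anti ole); rewrite l12 l23.
Qed.

Lemma mon_ltNge m1 m2 : monomial_order le -> mon_lt m1 m2 = ~~ le m2 m1.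
Proof.
move=> ole; apply/idP/idP.
  move=> /andP[l12 n12]; apply: contra n12 => l21.
  by apply/eqP/(mon_le_anti ole); rewrite l12.
have /orP[->//|l12 n21] := mon_le_total ole m2 m1.
by rewrite /mon_lt l12 /=; apply: contraNneq n21 => ->; exact: mon_le_refl.
Qed.

Lemma mon_lt_add m1 m2 m : monomial_order le ->
  mon_lt (m1 + m)%MM (m2 + m)%MM = mon_lt m1 m2.
Proof.
move=> ole; have add := mon_le_add ole m; apply/idP/idP; rewrite !(mon_ltNge _ _ ole).
  by apply: contra; apply: mon_le_add.
move=> h; have /orP[l|l] := mon_le_total ole m1 m2; last by rewrite l in h.
rewrite -mon_ltNge // /mon_lt (mon_le_add ole) //= eqm_add2r.
by apply: contraNneq h => ->; exact: mon_le_refl.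
Qed.

(** Adding the least monomial z to z <= 0 gives z + z <= z, hence z + z = z by minimality, and z =
    0. *)
Lemma mon_le0 m : monomial_order le -> le 0%MM m.
Proof.
move=> ole; have [_ wo _] := ole.
have [|z [[_ minz] _]] := wo predT; first by exists 0%MM.
suff -> : 0%MM = z by apply: minz.
have := mon_le_add ole z (minz 0%MM isT); rewrite add0m => zz.
have : (z + z)%MM = z by apply: (mon_le_anti ole); rewrite zz minz.
by rewrite -[RHS]add0m => /addIm.
Qed.

Lemma mon_lt_wf : monomial_order le -> well_founded mon_lt.
Proof.
move=> ole m; apply: contrapT => nAcc; have [_ wo _] := ole.
have [|z [[/asboolP zA minz] _]] := wo (fun m => `[< ~ Acc mon_lt m >]).
  by exists m; apply/asboolP.
apply: zA; constructor => y /andP[yz]; apply: contraNP => yA; apply/eqP.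
apply: (mon_le_anti ole); rewrite yz.
by apply: minz; apply/asboolP.
Qed.

End MonomialOrder.

(** * Dickson's lemma and the ascending chain argument *)

Section Dickson.

(** Choose repeatedly an index at which f is minimal on the tail that starts after the previous
    choice. *)
Lemma nat_sequence_mono (f : nat -> nat) :
  exists2 phi : nat -> nat, (forall k, phi k < phi k.+1)%N &
    forall k, (f (phi k) <= f (phi k.+1))%N.
Proof.
have tail k : exists j, (k <= j)%N /\ forall i, (j <= i)%N -> (f j <= f i)%N.
  have [v [[j [kj jv]] minv]] : exists v, (exists j, (k <= j)%N /\ f j = v) /\
      forall j, (k <= j)%N -> (v <= f j)%N.
    pose P v := `[< exists j, (k <= j)%N /\ f j = v >].
    have exP : exists v, P v by exists (f k); apply/asboolP; exists k.
    case: (ex_minnP exP) => v /asboolP vP minv; exists v; split=> // j kj.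
    by apply: minv; apply/asboolP; exists j.
  by exists j; split=> // i ji; rewrite jv; apply: minv; apply: leq_trans ji.
have [g gP] := choice tail.
pose phi := fix phi k := if k is k'.+1 then g (phi k').+1 else g 0%N.
have phiP k : forall i, (phi k <= i)%N -> (f (phi k) <= f i)%N.
  by case: k => [|k]; [exact: (gP 0%N).2|exact: (gP (phi k).+1).2].
have phi_lt k : (phi k < phi k.+1)%N by case: (gP (phi k).+1).
by exists phi => // k; apply: phiP; apply: ltnW.
Qed.

Lemma nat_increasing (phi : nat -> nat) : (forall k, phi k < phi k.+1)%N ->
  forall i j, (i < j)%N -> (phi i < phi j)%N.
Proof.
move=> inc i j; elim: j => // j IH; rewrite ltnS leq_eqVlt => /orP[/eqP->//|/IH].
by move=> h; apply: ltn_trans h _.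
Qed.

Lemma nat_nondecreasing (f : nat -> nat) : (forall k, f k <= f k.+1)%N ->
  forall i j, (i <= j)%N -> (f i <= f j)%N.
Proof. by move=> inc i j /subnK<-; elim: (j - i)%N => //= d IH; apply: leq_trans (inc _). Qed.

(** Refine the subsequence one coordinate at a time; d counts the coordinates already made
    nondecreasing. *)
Lemma dickson n (m : nat -> 'X_{1..n}) :
  exists2 phi : nat -> nat, (forall i j, i < j -> phi i < phi j)%N &
    forall i j, (i <= j)%N -> (m (phi i) <= m (phi j))%MM.
Proof.
suff /(_ n (leqnn n)) [phi inc mono] : forall d, (d <= n)%N ->
    exists2 phi : nat -> nat, (forall k, phi k < phi k.+1)%N &
    forall k (i : 'I_n), (i < d)%N -> (m (phi k) i <= m (phi k.+1) i)%N.
  exists phi; first exact: nat_increasing.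
  move=> i j ij; apply/mnm_lepP => l.
  by apply: (nat_nondecreasing (f := fun k => m (phi k) l)) => // k; apply: mono.
elim=> [|d IH] dn; first by exists id.
have [phi inc mono] := IH (ltnW dn).
have [psi inc' mono'] := nat_sequence_mono (fun k => m (phi k) (Ordinal dn)).
exists (phi \o psi) => [k|k i]; first exact: (nat_increasing inc).
rewrite ltnS leq_eqVlt => /orP[/eqP e|id].
  have -> : i = Ordinal dn by apply: val_inj.
  exact: mono'.
by apply: (nat_nondecreasing (f := fun k => m (phi k) i)) => [l|];
  [exact: mono|exact/ltnW].
Qed.

(** Abstract core of termination. Along a Dickson subsequence the partial sums S k of the A (phi i),
    i < k, stabilise, so for some k the ideal A (phi k) lies in S k, hence in D (phi k). *)
Lemma no_bad_sequence (R : idomainType) n (m : nat -> 'X_{1..n})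
    (A D : nat -> set {fraction R}) : noetherian R ->
  (forall k, is_submodule (A k)) -> (forall k, A k `<=` @Rfrac R) ->
  (forall k, is_submodule (D k)) ->
  (forall j k, (j < k)%N -> (m j <= m k)%MM -> A j `<=` D k) ->
  ~ (forall k, ~ A k `<=` D k).
Proof.
move=> nR sA AR sD AD bad.
have [phi inc mono] := dickson m.
pose S k := sumset xpredT (fun i : 'I_k => A (phi i)).
have sS k : is_submodule (S k) by apply: submodule_sumset.
have AS i k : (i < k)%N -> A (phi i) `<=` S k.
  by move=> ik x Ax; apply: (@sumset_mem _ _ _ (fun i : 'I_k => A (phi i)) (Ordinal ik)).
have SS k : S k `<=` S k.+1.
  by apply: sumset_sub => // i _; apply: AS; apply: ltnW; rewrite ltnS.
have [k kP] := @noetherian_chain R (fun k => trace_ideal (S k)) nR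
  (fun k => is_ideal_trace (sS k)) (fun k r => SS k (tofrac r)).
apply: (bad (phi k)) => x Ax.
suff : S k x.
  apply: sumset_sub => // i _; apply: AD; first exact: inc.
  by apply: mono; apply: ltnW.
have [r _ er] := AR _ _ Ax; rewrite -er; apply: (kP k.+1).
by rewrite /trace_ideal /= er; apply: AS Ax.
Qed.

End Dickson.

(** * Buchberger's criterion *)

Section Representation.
Variables (R : idomainType) (n : nat) (le : rel 'X_{1..n}).
Local Notation K := {fraction R}.
Local Notation Kx := {mpoly K[n]}.
Local Notation Rf := (@Rfrac R).
Local Notation pseudo := (pseudo R n).
Local Notation deg := (mdeg_lead le).
Local Notation lc := (lc le).
Local Notation tuple_of := Defs.tuple_of.
Implicit Types (f g : Kx) (p q : pseudo) (G : seq pseudo) (m k d : 'X_{1..n}).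

Lemma mem_le_bigmax (s : seq 'X_{1..n}) m : monomial_order le -> m \in s ->
  le m (\big[(fun m1 m2 => if le m1 m2 then m2 else m1)/0%MM]_(k <- s) k).
Proof.
move=> ole; elim: s => // a s IH; rewrite inE big_cons => /orP[/eqP->|/IH h].
  by case: ifP => // _; exact: mon_le_refl.
case: ifP => // /negbT; rewrite -mon_ltNge // => /andP[h' _].
exact: mon_le_trans h h'.
Qed.

Lemma bigmax_mem (s : seq 'X_{1..n}) : monomial_order le -> s != [::] ->
  \big[(fun m1 m2 => if le m1 m2 then m2 else m1)/0%MM]_(k <- s) k \in s.
Proof.
move=> ole; elim: s => // a s IH _; rewrite big_cons.
have [->|/IH h] := eqVneq s [::].
  (* A one-element list is compared with the neutral element 0, which is harmless because 0 is the
     least monomial. *)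
  rewrite big_nil inE; case: ifP => // h; apply/eqP/(mon_le_anti ole).
  by rewrite h mon_le0.
by case: ifP => _; rewrite inE ?eqxx ?h ?orbT.
Qed.

Lemma mcoeff_le_deg f m : monomial_order le -> f@_m != 0 -> le m (deg f).
Proof. by move=> ole; rewrite -mcoeff_msupp; apply: mem_le_bigmax. Qed.

Lemma lc_neq0 f : monomial_order le -> f != 0 -> lc f != 0.
Proof.
by move=> ole f0; rewrite /lc -mcoeff_msupp; apply: bigmax_mem; rewrite // msupp_eq0.
Qed.

Lemma deg_eq f m : monomial_order le -> f@_m != 0 ->
  (forall k, f@_k != 0 -> le k m) -> deg f = m.
Proof.
move=> ole fm fle; apply: (mon_le_anti ole); rewrite (mcoeff_le_deg ole fm) andbT.
apply: fle; apply: lc_neq0 => //; apply: contraNneq fm => ->; by rewrite mcoeff0.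
Qed.

Lemma deg1 : monomial_order le -> deg (1 : Kx) = 0%MM.
Proof.
move=> ole; apply: deg_eq => // [|k]; first by rewrite mcoeff1 eqxx oner_neq0.
by rewrite mcoeff1; have [->|] := eqVneq k 0%MM; rewrite ?eqxx // mon_le_refl.
Qed.

Lemma lc1 : monomial_order le -> lc (1 : Kx) = 1.
Proof. by move=> ole; rewrite /lc deg1 // mcoeff1 eqxx. Qed.

Lemma mcoeffXM f m k : ('X_[m] * f)@_(m + k) = f@_k.
Proof. by rewrite mulrC mcoeffMX. Qed.

Lemma mcoeffXM_sub f m k : (m <= k)%MM -> ('X_[k - m] * f)@_k = f@_m.
Proof. by move=> mk; have := mcoeffXM f (k - m) m; rewrite submK. Qed.

Lemma mcoeffXM_dvd f m k : ('X_[m] * f)@_k != 0 -> (m <= k)%MM /\ f@_(k - m) != 0.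
Proof.
rewrite mulrC -mcoeff_msupp (perm_mem (msuppMX _ _)) => /mapP[l lf ->].
by rewrite lem_addr addmC addmK -mcoeff_msupp.
Qed.

Lemma mcoeffXM_le f m k : monomial_order le -> ('X_[m] * f)@_k != 0 ->
  le k (m + deg f)%MM.
Proof.
move=> ole /mcoeffXM_dvd[mk /(mcoeff_le_deg ole) h].
by rewrite -(submK mk) [X in le _ X]addmC mon_le_add.
Qed.

(* Q constrains the leading exponents of the summands, so that cancellation
   between summands is visible. *)
Inductive rep G (Q : 'X_{1..n} -> Prop) : Kx -> Prop :=
| rep_nil : rep G Q 0
| rep_cons p c m f : p \in G -> p.2 c -> Q (m + deg p.1)%MM -> rep G Q f ->
    rep G Q (c *: ('X_[m] * p.1) + f).

Lemma rep_term G (Q : 'X_{1..n} -> Prop) p c m : p \in G -> p.2 c ->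
  Q (m + deg p.1)%MM -> rep G Q (c *: ('X_[m] * p.1)).
Proof. by move=> pG pc Qm; rewrite -[X in rep _ _ X]addr0; apply: rep_cons => //; exact: rep_nil. Qed.

Lemma repD G Q f g : rep G Q f -> rep G Q g -> rep G Q (f + g).
Proof.
move=> rf rg; elim: rf => [|p c m h pG pc Qm _ IH]; first by rewrite add0r.
by rewrite -addrA; apply: rep_cons.
Qed.

Lemma rep_sum G Q (I : Type) (r : seq I) (P : pred I) (F : I -> Kx) :
  (forall i, P i -> rep G Q (F i)) -> rep G Q (\sum_(i <- r | P i) F i).
Proof. by move=> rF; apply: (big_ind (rep G Q)) => //; [exact: rep_nil|exact: repD]. Qed.

Lemma rep_mono G G' (Q Q' : 'X_{1..n} -> Prop) f : {subset G <= G'} ->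
  (forall m, Q m -> Q' m) -> rep G Q f -> rep G' Q' f.
Proof.
move=> GG QQ; elim=> [|p c m h pG pc Qm _ IH]; first exact: rep_nil.
by apply: rep_cons => //; [exact: GG|exact: QQ].
Qed.

Lemma repZ G Q r f : (forall p, p \in G -> is_submodule p.2) -> Rf r ->
  rep G Q f -> rep G Q (r *: f).
Proof.
move=> sG Rr; elim=> [|p c m h pG pc Qm _ IH]; first by rewrite scaler0; exact: rep_nil.
rewrite scalerDr scalerA; apply: rep_cons => //.
by have [_ _] := sG p pG; apply.
Qed.

Lemma repXM G (Q Q' : 'X_{1..n} -> Prop) m f : (forall k, Q k -> Q' (m + k)%MM) ->
  rep G Q f -> rep G Q' ('X_[m] * f).
Proof.
move=> QQ; elim=> [|p c k h pG pc Qk _ IH]; first by rewrite mulr0; exact: rep_nil.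
rewrite mulrDr -scalerAr mulrA -mpolyXD; apply: rep_cons => //.
by rewrite -addmA; apply: QQ.
Qed.

Lemma rep_supp_lt G d f k : monomial_order le ->
  rep G (fun m => mon_lt le m d) f -> f@_k != 0 -> mon_lt le k d.
Proof.
move=> ole; elim=> [|p c m h pG pc Qm _ IH]; first by rewrite mcoeff0 eqxx.
have [/eqP h0|/IH//] := boolP (h@_k == 0).
rewrite mcoeffD h0 addr0 mcoeffZ mulf_eq0 => /norP[_ /(mcoeffXM_le ole) kle].
exact: mon_le_lt_trans kle Qm.
Qed.

(** A finite sum attains its largest leading exponent d'. This turns a strict bound into a smaller
    weak one and so makes descent on d possible. *)
Lemma rep_bounded G d f : monomial_order le -> rep G (fun m => mon_lt le m d) f ->
  f = 0 \/ exists2 d', mon_lt le d' d & rep G (fun m => le m d') f.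
Proof.
move=> ole; elim=> [|p c m h pG pc Qm rh IH]; [by left|right].
have [->|[d' d'd rh']] := IH.
  exists (m + deg p.1)%MM => //; apply: rep_cons => //; last exact: rep_nil.
  exact: mon_le_refl.
have [l|l] := orP (mon_le_total ole (m + deg p.1)%MM d').
  by exists d' => //; apply: rep_cons.
exists (m + deg p.1)%MM => //; apply: rep_cons => //; first exact: mon_le_refl.
by apply: rep_mono rh' => // k /(mon_le_trans ole); apply.
Qed.

Lemma rep_bound G f : monomial_order le -> rep G (fun=> True) f ->
  exists d, rep G (fun m => le m d) f.
Proof.
move=> ole; elim=> [|p c m h pG pc _ rh [d rh']]; first by exists 0%MM; exact: rep_nil.
have [l|l] := orP (mon_le_total ole (m + deg p.1)%MM d).
  by exists d => //; apply: rep_cons.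
exists (m + deg p.1)%MM => //; apply: rep_cons => //; first exact: mon_le_refl.
by apply: rep_mono rh' => // k /(mon_le_trans ole); apply.
Qed.

Lemma tuple_of_mem G (i : 'I_(size G)) : tuple_of i \in G.
Proof. exact: (mem_tnth i (in_tuple G)). Qed.

Lemma tuple_ofP G p : p \in G -> exists i : 'I_(size G), tuple_of i = p.
Proof.
move=> pG; have ip : (index p G < size G)%N by rewrite index_mem.
by exists (Ordinal ip); rewrite /tuple_of (tnth_nth p) /= nth_index.
Qed.

(** Passes from single terms c x^m p to one polynomial coefficient per member; [gen_rep] splits
    these again. *)
Lemma rep_gen G f : (forall p, p \in G -> is_submodule p.2) ->
  rep G (fun=> True) f -> gen G f.
Proof.
move=> sG; elim=> [|p c m h pG pc _ _ [y [yP ->]]].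
  exists (fun=> 0); rewrite big1 //; split=> // i _; exists 0; rewrite ?mul0r //.
  by move=> k; rewrite mcoeff0; case: (sG _ (tuple_of_mem i)).
have [i ei] := tuple_ofP pG.
exists (fun j => (if j == i then c *: ('X_[m] * p.1) else 0) + y j); split; last first.
  by rewrite big_split /= -big_mkcond big_pred1_eq.
move=> j _; have [a aj <-] := yP j isT.
have [eji|_] := eqVneq j i; last by exists a; rewrite ?add0r.
rewrite eji ei in aj *; exists (c *: 'X_[m] + a); last by rewrite mulrDl scalerAl.
move=> k; rewrite mcoeffD mcoeffZ mcoeffX; have [A0 AD _] := sG p pG.
by apply: AD; [case: eqP; rewrite ?mulr1 ?mulr0|exact: aj].
Qed.

Lemma gen_rep G f : gen G f -> rep G (fun=> True) f.
Proof.
move=> [y [yP ->]]; apply: rep_sum => i _; have [a aG <-] := yP i isT.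
rewrite (mpolyE a) mulr_suml; apply: rep_sum => m _; rewrite -scalerAl.
exact: (rep_term (tuple_of_mem i) (aG m) I).
Qed.

(** Only summands of leading exponent exactly d can contribute to the coefficient of x^d; they are
    merged by member. *)
Lemma rep_top G d f : monomial_order le -> (forall p, p \in G -> is_submodule p.2) ->
    rep G (fun m => le m d) f ->
  exists c : 'I_(size G) -> K, exists h, [/\ forall i, (tuple_of i).2 (c i),
    rep G (fun m => mon_lt le m d) h &
    f = \sum_(i | (deg (tuple_of i).1 <= d)%MM)
          c i *: ('X_[d - deg (tuple_of i).1] * (tuple_of i).1) + h].
Proof.
move=> ole sG; elim=> [|p c m f' pG pc lem _ [c' [h [c'G rh ->]]]].
  exists (fun=> 0), 0; split; [|exact: rep_nil|].
    by move=> i; case: (sG _ (tuple_of_mem i)).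
  by rewrite big1 ?addr0 // => i _; rewrite scale0r.
have [ed|nd] := eqVneq (m + deg p.1)%MM d; last first.
  exists c', (c *: ('X_[m] * p.1) + h); split=> //; last by rewrite addrCA.
  by apply: rep_cons => //; apply/andP.
have [i ei] := tuple_ofP pG.
exists (fun j => (if j == i then c else 0) + c' j), h; split=> //.
  move=> j; have [A0 AD _] := sG _ (tuple_of_mem j).
  by apply: AD => //; case: eqP => // ->; rewrite ei.
rewrite addrA; congr (_ + _); under [RHS]eq_bigr do rewrite scalerDl.
rewrite big_split /=; congr (_ + _); rewrite (bigD1 i) /= ?ei -?ed ?lem_addl //.
rewrite eqxx addmK big1 ?addr0 // => j /andP[_ /negPf->].
by rewrite scale0r.
Qed.

Lemma submodule_lc_ideal p : is_pseudo p -> is_submodule (lc_ideal le p).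
Proof. by move=> [fp _]; apply: submodule_scale; apply: fractional_submodule. Qed.

Lemma lc_ideal_Rfrac p : is_pseudo p -> lc_ideal le p `<=` Rf.
Proof. by move=> [_ pR] _ [a pa <-]; rewrite -mcoeffZ; apply: pR. Qed.

(** Buchberger's condition for one pair; z ranges over the ideal part of the S-polynomial. *)
Definition spoly_rep G p q := forall z, lc_ideal le p z -> lc_ideal le q z ->
  rep G (fun m => mon_lt le m (mlcm (deg p.1) (deg q.1))) (z *: (spoly le p q).1).

Lemma mlcm_dvd m k d : (m <= d)%MM -> (k <= d)%MM ->
  (d - m = (d - mlcm m k) + (mlcm m k - m))%MM.
Proof.
move=> md kd; have ld : (mlcm m k <= d)%MM by rewrite lem_mlcm md.
by rewrite addmBA ?lem_mlcml // submK.
Qed.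

(** The difference is the S-polynomial times the monomial of exponent d minus the lcm, and this
    shift preserves strict inequalities. *)
Lemma spoly_rep_lift G p q z d : spoly_rep G p q ->
    lc_ideal le p z -> lc_ideal le q z -> monomial_order le ->
    (deg p.1 <= d)%MM -> (deg q.1 <= d)%MM ->
  rep G (fun m => mon_lt le m d)
    (z *: ('X_[d - deg p.1] * ((lc p.1)^-1 *: p.1)
           - 'X_[d - deg q.1] * ((lc q.1)^-1 *: q.1))).
Proof.
move=> gpq pz qz ole pd qd; set l := mlcm (deg p.1) (deg q.1).
have ld : (l <= d)%MM by rewrite lem_mlcm pd.
rewrite (mlcm_dvd pd qd) [(d - deg q.1)%MM](mlcm_dvd qd pd).
rewrite [mlcm (deg q.1) _]mlcmC -/l !mpolyXD -!mulrA -mulrBr scalerAr.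
apply: repXM (gpq z pz qz) => k kl; rewrite -[d in mon_lt le _ d](submK ld).
by rewrite addmC [X in mon_lt le _ X]addmC mon_lt_add.
Qed.

(* The syzygies of the leading terms of degree d are generated by those of
   pairs: if 1 = sum u_i with u_i (sum_j A_j) <= A_i and sum y_i = 0, then
   y_i = sum_j (u_j y_i - u_i y_j) and u_j y_i lies in both A_i and A_j. *)
Lemma rep_cancel G d f : dedekind_domain R -> monomial_order le ->
    (forall p, p \in G -> is_pseudo p /\ p.1 != 0) ->
    (forall p q, p \in G -> q \in G -> spoly_rep G p q) ->
    rep G (fun m => le m d) f -> f@_d = 0 -> rep G (fun m => mon_lt le m d) f.
Proof.
move=> dR ole pG good rf fd0.
have sG p : p \in G -> is_submodule p.2.
  by move=> /pG[[/fractional_submodule]].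
have [c [h [cG rh ef]]] := rep_top ole sG rf.
rewrite ef; apply: repD => //.
pose P (i : 'I_(size G)) := (deg (tuple_of i).1 <= d)%MM.
pose A (i : 'I_(size G)) := lc_ideal le (tuple_of i).
pose y (i : 'I_(size G)) := c i * lc (tuple_of i).1.
have sA i : P i -> is_submodule (A i).
  by move=> _; apply: submodule_lc_ideal; case: (pG _ (tuple_of_mem i)).
have yA i : A i (y i) by exists (c i).
have l0 (i : 'I_(size G)) : lc (tuple_of i).1 != 0.
  by apply: lc_neq0 => //; case: (pG _ (tuple_of_mem i)).
have y0 : \sum_(i | P i) y i = 0.
  rewrite -[RHS]fd0 ef mcoeffD; have -> : h@_d = 0.
    apply/eqP; apply: contraT => /(rep_supp_lt ole rh).
    by rewrite mon_ltNge // mon_le_refl.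
  rewrite addr0 raddf_sum; apply: eq_bigr => i Pi /=.
  by rewrite mcoeffZ mcoeffXM_sub.
(* The partition of 1 requires a non-zero sum of ideals, which a non-zero c i provides. *)
have [[i Pi ci0]|noc] := pselect (exists2 i, P i & c i != 0); last first.
  apply: rep_sum => i Pi; have -> : c i = 0.
    by apply/eqP; apply: contraT => ci0; case: noc; exists i.
  by rewrite scale0r; exact: rep_nil.
have [||u [u1 uR uA]] := dedekind_partition dR sA.
- by move=> j _; apply: lc_ideal_Rfrac; case: (pG _ (tuple_of_mem j)).
- by exists (y i); [apply: (sumset_mem sA Pi)|rewrite mulf_neq0].
(* For i in P, e i has leading coefficient 1 at exponent d, so e i - e j is a shifted
   S-polynomial. *)
pose e (i : 'I_(size G)) := 'X_[d - deg (tuple_of i).1]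
  * ((lc (tuple_of i).1)^-1 *: (tuple_of i).1).
have -> : \sum_(i | P i)
    c i *: ('X_[d - deg (tuple_of i).1] * (tuple_of i).1) =
  \sum_(i | P i) \sum_(j | P j) (u j * y i) *: (e i - e j).
  transitivity (\sum_(i | P i) y i *: e i).
    by apply: eq_bigr => j _; rewrite /e -scalerAr scalerA /y mulfK.
  transitivity (\sum_(i | P i) \sum_(j | P j) (u j * y i) *: e i
                - \sum_(i | P i) \sum_(j | P j) (u j * y i) *: e j).
    rewrite [X in _ - X]exchange_big /= [X in _ - X]big1 ?subr0; last first.
      by move=> j _; rewrite -scaler_suml -mulr_sumr y0 mulr0 scale0r.
    by apply: eq_bigr => j _; rewrite -scaler_suml -mulr_suml u1 mul1r.
  rewrite -sumrB; apply: eq_bigr => j _; rewrite -sumrB; apply: eq_bigr => k _.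
  by rewrite scalerBr.
apply: rep_sum => j Pj; apply: rep_sum => k Pk.
apply: spoly_rep_lift => //.
- by apply: good; exact: tuple_of_mem.
- by have [_ _] := sA j Pj; apply => //; apply: uR.
- by apply: uA => //; apply: (sumset_mem sA Pj).
Qed.

Lemma polys_in_XM (A : set K) c m : A 0 -> A c -> polys_in A (c *: 'X_[m] : Kx).
Proof. by move=> A0 Ac k; rewrite mcoeffZ mcoeffX; case: eqP; rewrite ?mulr1 ?mulr0. Qed.

(** Descent on the bound d: if the coefficient at d vanishes, [rep_cancel] lowers d; otherwise d is
    the degree of f and the top summands add up to its leading term. *)
Lemma rep_lt G f : dedekind_domain R -> monomial_order le ->
    (forall p, p \in G -> is_pseudo p /\ p.1 != 0) ->
    (forall p q, p \in G -> q \in G -> spoly_rep G p q) ->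
    rep G (fun=> True) f -> f != 0 -> Lt_fam le G (lt le f).
Proof.
move=> dR ole pG good /(rep_bound ole)[d]; elim: (mon_lt_wf ole d) f => {}d _ IH f rf f0.
have sG p : p \in G -> is_submodule p.2.
  by move=> /pG[[/fractional_submodule]].
have [/eqP fd|fd] := boolP (f@_d == 0).
  have [f00|[d' d'd rf']] := rep_bounded ole (rep_cancel dR ole pG good rf fd).
    by rewrite f00 eqxx in f0.
  exact: IH d'd f rf' f0.
have [c [h [cG rh ef]]] := rep_top ole sG rf.
have hd : h@_d = 0.
  apply/eqP; apply: contraT => /(rep_supp_lt ole rh).
  by rewrite mon_ltNge // mon_le_refl.
have degf : deg f = d.
  apply: deg_eq => // k; rewrite ef mcoeffD.
  have [/eqP ->|/(rep_supp_lt ole rh)/andP[] //] := boolP (h@_k == 0).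
  rewrite addr0 raddf_sum => s0; apply: contraT => nkd; case/eqP: s0.
  rewrite big1 //= => i Pi; rewrite mcoeffZ; apply/eqP; rewrite mulf_eq0; apply/orP; right.
  apply: contraNT nkd => /(mcoeffXM_le ole).
  by rewrite submK.
exists (fun i => if (deg (tuple_of i).1 <= d)%MM then
  (c i *: 'X_[d - deg (tuple_of i).1]) * lt le (tuple_of i).1 else 0); split.
  move=> i _; have [A0 _ _] := sG _ (tuple_of_mem i); case: ifP => Pi.
    by exists (c i *: 'X_[d - deg (tuple_of i).1]) => //; apply: polys_in_XM.
  by exists 0; rewrite ?mul0r // => k; rewrite mcoeff0.
rewrite -big_mkcond /= /lt /lm -[lc f]/(f@_(deg f)) degf {1}ef mcoeffD hd addr0 raddf_sum.
rewrite scaler_suml; apply: eq_bigr => i Pi /=.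
rewrite mcoeffZ mcoeffXM_sub // -scalerAl -scalerAr -mpolyXD submK //.
by rewrite scalerA.
Qed.

End Representation.

(** * The algorithm *)

Section Algorithm.
Variables (R : idomainType) (n : nat) (le : rel 'X_{1..n}).
Local Notation K := {fraction R}.
Local Notation Kx := {mpoly K[n]}.
Local Notation Rf := (@Rfrac R).
Local Notation pseudo := (pseudo R n).
Local Notation state := (state R n).
Local Notation deg := (mdeg_lead le).
Local Notation lc := (lc le).
Local Notation tuple_of := Defs.tuple_of.
Local Notation mlt := (mon_lt le).
Implicit Types (f g : Kx) (p q h : pseudo) (G F : seq pseudo) (m k d : 'X_{1..n}).
Implicit Types (A : set K) (N : set R) (T : set (pseudo * pseudo)) (s : state).

(** Stands in for deg f < d, which would be meaningless at f = 0. *)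
Definition supp_lt f d := forall k, f@_k != 0 -> mlt k d.

Lemma supp_lt_deg f d : monomial_order le -> f != 0 -> supp_lt f d -> mlt (deg f) d.
Proof. by move=> ole f0; apply; apply: lc_neq0. Qed.

Lemma degZ (c : K) f : monomial_order le -> c != 0 -> f != 0 -> deg (c *: f) = deg f.
Proof.
move=> ole c0 f0; apply: deg_eq => // [|k]; rewrite mcoeffZ mulf_eq0 negb_or.
  by rewrite c0 lc_neq0.
by move=> /andP[_]; apply: mcoeff_le_deg.
Qed.

Lemma degXM m f : monomial_order le -> f != 0 -> deg ('X_[m] * f) = (m + deg f)%MM.
Proof.
move=> ole f0; apply: deg_eq => // [|k]; first by rewrite mcoeffXM lc_neq0.
exact: mcoeffXM_le.
Qed.

Lemma polys_inD A f g : is_submodule A -> polys_in A f -> polys_in A g -> polys_in A (f + g).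
Proof. by move=> [_ AD _] Af Ag k; rewrite mcoeffD; apply: AD. Qed.

Lemma polys_in0 A : is_submodule A -> polys_in A (0 : Kx).
Proof. by move=> [A0 _ _] k; rewrite mcoeff0. Qed.

Lemma polys_inN A f : is_submodule A -> polys_in A f -> polys_in A (- f).
Proof. by move=> sA Af k; rewrite mcoeffN; apply: submoduleN. Qed.

Lemma polys_inM A f g : is_submodule A -> polys_in Rf f -> polys_in A g -> polys_in A (f * g).
Proof.
move=> sA Rf Ag k; rewrite mcoeffM; apply: submodule_sum => // i _.
by have [_ _] := sA; apply.
Qed.

Lemma polys_inX m : polys_in Rf ('X_[m] : Kx).
Proof. by rewrite -[X in polys_in _ X]scale1r; apply: polys_in_XM; [case: (submodule_Rfrac R)|exact: Rfrac1]. Qed.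

Lemma rep_polys_in G Q f : (forall p, p \in G -> is_pseudo p) ->
  rep le G Q f -> polys_in Rf f.
Proof.
have sR := submodule_Rfrac R.
move=> pG; elim=> [|p c m h pinG pc _ _ IH]; first exact: polys_in0.
apply: polys_inD => //; rewrite scalerAr; apply: polys_inM => //; first exact: polys_inX.
by have [_] := pG p pinG; apply.
Qed.

Lemma rep_trans G G' f :
  (forall p c, p \in G -> p.2 c -> rep le G' (fun=> True) (c *: p.1)) ->
  rep le G (fun=> True) f -> rep le G' (fun=> True) f.
Proof.
move=> GG; elim=> [|p c m h pG pc _ _ IH]; first exact: rep_nil.
by apply: repD => //; rewrite scalerAr; apply: repXM (GG p c pG pc).
Qed.

(** Since 1 has exponent 0, the summands are the terms of f themselves and no exponent outside its
    support appears. *)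
Lemma rep_one G (Q : 'X_{1..n} -> Prop) A f : monomial_order le -> (1, A) \in G ->
  polys_in A f -> (forall k, f@_k != 0 -> Q k) -> rep le G Q f.
Proof.
move=> ole G1 Af fQ; rewrite [f]mpolyE big_seq; apply: rep_sum => m.
rewrite mcoeff_msupp => /fQ Qm; rewrite -['X_[m]]mulr1.
by apply: (rep_term G1) => //=; rewrite deg1 // addm0.
Qed.

Lemma lc_ideal_neq0 p : monomial_order le -> is_pseudo p -> p.1 != 0 ->
  exists2 a, lc_ideal le p a & a != 0.
Proof.
move=> ole [[_ [a pa a0]] _] p0; exists (a * lc p.1); first by exists a.
by rewrite mulf_neq0 // lc_neq0.
Qed.

(** An element common to both leading coefficient ideals clears both denominators of the
    S-polynomial. *)
Lemma spolyE p q a b : monomial_order le -> p.1 != 0 -> q.1 != 0 ->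
  a * lc p.1 = b * lc q.1 ->
  (a * lc p.1) *: (spoly le p q).1 =
    'X_[mlcm (deg p.1) (deg q.1) - deg p.1] * (a *: p.1)
    - 'X_[mlcm (deg p.1) (deg q.1) - deg q.1] * (b *: q.1).
Proof.
move=> ole p0 q0 e; rewrite scalerBr {2}e -!scalerAr !scalerA.
by rewrite !mulfK // lc_neq0.
Qed.

Lemma is_pseudo_spoly p q : dedekind_domain R -> monomial_order le ->
  is_pseudo p -> p.1 != 0 -> is_pseudo q -> q.1 != 0 -> is_pseudo (spoly le p q).
Proof.
move=> [nR _ _] ole pp p0 pq q0; have sR := submodule_Rfrac R.
have sp := submodule_lc_ideal le pp; have sq := submodule_lc_ideal le pq.
split.
  apply: (@fractionalP _ _ 1) => //=; first exact: submodule_setI.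
  - exact: oner_neq0.
  - by move=> z [/(lc_ideal_Rfrac pp) pz _]; rewrite mul1r.
  - have [a pa a0] := lc_ideal_neq0 ole pp p0; have [b qb b0] := lc_ideal_neq0 ole pq q0.
    (* Both ideals are contained in R, so the product lies in their intersection. *)
    exists (a * b); last by rewrite mulf_neq0.
    split; first by rewrite mulrC; case: sp => _ _; apply => //; apply: lc_ideal_Rfrac qb.
    by case: sq => _ _; apply => //; apply: lc_ideal_Rfrac pa.
move=> z [[a pa <-] [b qb e]]; rewrite (spolyE ole p0 q0 (esym e)).
apply: polys_inD => //; [|apply: polys_inN => //]; apply: polys_inM => //; try exact: polys_inX.
  by case: pp => _; apply.
by case: pq => _; apply.
Qed.

Lemma spoly_supp_lt p q : monomial_order le -> p.1 != 0 -> q.1 != 0 ->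
  supp_lt (spoly le p q).1 (mlcm (deg p.1) (deg q.1)).
Proof.
move=> ole p0 q0 k; set l := mlcm _ _ => kne; apply/andP; split; last first.
  apply: contraNneq kne => ->; rewrite mcoeffB !mcoeffXM_sub ?lem_mlcml ?lem_mlcmr //.
  by rewrite !mcoeffZ !mulVf ?subrr // lc_neq0.
apply: contraT => nkl; case/negP: kne; rewrite mcoeffB.
have zero r : r.1 != 0 -> (deg r.1 <= l)%MM ->
    ('X_[l - deg r.1] * ((lc r.1)^-1 *: r.1))@_k = 0 :> K.
  move=> r0 rl; apply/eqP; apply: contraNT nkl => /(mcoeffXM_le ole).
  by rewrite degZ ?submK // invr_eq0 lc_neq0.
by rewrite !zero ?lem_mlcml ?lem_mlcmr // subrr.
Qed.

Lemma spoly_sym p q : (spoly le q p).1 = - (spoly le p q).1.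
Proof. by rewrite /spoly /= mlcmC opprB. Qed.

Lemma spoly_rep_sym G p q : (forall r, r \in G -> is_submodule r.2) ->
  spoly_rep le G p q -> spoly_rep le G q p.
Proof.
move=> sG pq z qz pz; rewrite mlcmC spoly_sym scalerN -scaleN1r.
by apply: repZ => //; [exact/RfracN/Rfrac1|exact: pq].
Qed.

(** * Existence and effect of reductions *)

(** With f the ideal part of p, write 1 as a sum of z.1 * z.2 with z.1 in f and z.2 in f^-1.
    Containment decomposes each z.1 * lc p.1; recombining with the z.2 yields coefficients a_i in
    g_i f^-1. *)
Lemma one_step_exists G p : dedekind_domain R -> monomial_order le -> is_pseudo p ->
  p.1 != 0 -> can_be_reduced le G p -> exists q, one_step_reduction le G p q.
Proof.
move=> dR ole pp p0 red; have [fp pR] := pp.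
have [|s [sP e1]] := @dedekind_invertible _ p.2 (lc p.1) dR
  (fractional_submodule fp) fp.2 (lc_neq0 ole p0).
  by move=> a pa; rewrite mulrC -mcoeffZ; apply: pR.
have /choice[y yP] : forall z : K * K, exists y : 'I_(size G) -> K, z \in s ->
    (forall i, lm_divides le p.1 i -> (tuple_of i).2 (y i)) /\
    z.1 * lc p.1 = \sum_(i | lm_divides le p.1 i) y i * lc (tuple_of i).1.
  move=> z; have [/sP[pz _]|zs] := boolP (z \in s); last by exists (fun=> 0).
  have [|w [wP ew]] := red (z.1 * lc p.1); first by exists z.1.
  have /choice[y yP] : forall i, exists c, lm_divides le p.1 i ->
      (tuple_of i).2 c /\ c * lc (tuple_of i).1 = w i.
    move=> i; have [/wP[c ic ec]|] := boolP (lm_divides le p.1 i); first by exists c.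
    by exists 0.
  exists y => _; split=> [i /yP[]//|]; rewrite ew; apply: eq_bigr => i /yP[_ ->//].
pose a i := \sum_(z <- s) y z i * z.2.
exists (p.1 - \sum_(i | lm_divides le p.1 i)
  a i *: ('X_[deg p.1 - deg (tuple_of i).1] * (tuple_of i).1), p.2).
split=> //; exists a; split=> //.
  move=> i Pi; exists [seq (y z i, z.2) | z <- s]; rewrite big_map; split=> //.
  move=> _ /mapP[z zs ->]; split; last by case: (sP _ zs).
  by have [+ _] := yP z zs; apply.
rewrite -[LHS]mul1r e1 mulr_suml.
under [RHS]eq_bigr do rewrite mulr_suml.
rewrite exchange_big big_seq [RHS]big_seq; apply: eq_bigr => z zs /=.
have [_ e] := yP z zs; rewrite mulrAC e mulr_suml; apply: eq_bigr => i _.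
by rewrite mulrAC.
Qed.

(** As a_i lies in g_i f^-1, multiplying by z in f brings it into g_i, so z times the subtracted
    part is an admissible combination. *)
Lemma one_step_rep G p q : monomial_order le -> (forall r, r \in G -> is_pseudo r) ->
    is_pseudo p -> one_step_reduction le G p q ->
  [/\ is_pseudo q, q.2 = p.2, supp_lt q.1 (deg p.1) &
    forall z, p.2 z -> rep le G (fun m => le m (deg p.1)) (z *: (p.1 - q.1))].
Proof.
move=> ole pG pp [p0 [a [aP ea ->]]] /=.
set S := \sum_(i | _) _.
have sR := submodule_Rfrac R.
have rz z : p.2 z -> rep le G (fun m => le m (deg p.1)) (z *: (p.1 - (p.1 - S))).
  move=> pz; rewrite opprB addrCA subrr addr0 scaler_sumr; apply: rep_sum => i Pi.
  rewrite scalerA; apply: (rep_term (tuple_of_mem i)); last first.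
    by rewrite submK //; exact: mon_le_refl.
  have sT := fractional_submodule (pG _ (tuple_of_mem i)).1.
  have [s [sP ->]] := aP i Pi; rewrite mulr_sumr; apply: submodule_sum_seq => // w /sP[w1 w2].
  by rewrite mulrCA mulrC; case: sT => _ _; apply => //; apply: fid_inv_id pz.
split=> //.
  split; first by case: pp.
  move=> z /= pz; have -> : z *: (p.1 - S) = z *: p.1 - z *: (p.1 - (p.1 - S)).
    by rewrite -scalerBr opprB addrCA subrr addr0.
  apply: polys_inD => //; first by case: pp => _; apply.
  by apply: polys_inN => //; apply: rep_polys_in (rz z pz).
move=> k kne; apply/andP; split; last first.
  apply: contraNneq kne => ->; rewrite mcoeffB raddf_sum /= -[p.1@__]/(lc p.1) ea subr_eq0.
  by apply/eqP/eq_bigr => i Pi; rewrite mcoeffZ mcoeffXM_sub.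
apply: contraT => nkp; case/negP: kne; rewrite mcoeffB raddf_sum /= big1 ?subr0.
  by apply: contraNT nkp; apply: mcoeff_le_deg.
move=> i Pi; rewrite mcoeffZ; apply/eqP; rewrite mulf_eq0; apply/orP; right.
by apply: contraNT nkp => /(mcoeffXM_le ole); rewrite submK.
Qed.

Lemma reduces_to_rep G p q d : monomial_order le -> (forall r, r \in G -> is_pseudo r) ->
    reduces_to le G p q -> is_pseudo p -> supp_lt p.1 d ->
  [/\ is_pseudo q, q.2 = p.2, supp_lt q.1 d &
    forall z, p.2 z -> rep le G (fun m => mlt m d) (z *: (p.1 - q.1))].
Proof.
move=> ole pG; elim=> {p q} [p q pq|p|p q r _ IH _ IH'] pp pd.
- have [qq eq qd rz] := one_step_rep ole pG pp pq; have [p0 _] := pq.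
  have dd := supp_lt_deg ole p0 pd; split=> //.
    by move=> k /qd /andP[h _]; apply: mon_le_lt_trans h dd.
  by move=> z /rz; apply: rep_mono => // k h; apply: mon_le_lt_trans h dd.
- by split=> // z _; rewrite subrr scaler0; exact: rep_nil.
- have [pq eq qd rq] := IH pp pd; have [pr er rd rr] := IH' pq qd.
  split=> //; first by rewrite er.
  move=> z pz; rewrite -[p.1](subrK q.1) -addrA scalerDr.
  by apply: repD; [exact: rq|apply: rr; rewrite eq].
Qed.

Lemma reduction_exists G p : dedekind_domain R -> monomial_order le ->
    (forall r, r \in G -> is_pseudo r) -> is_pseudo p ->
  exists h, reduces_to le G p h /\ (h.1 = 0 \/ is_minimal le G h).
Proof.
move=> dR ole pG; move: {2}(deg p.1) (erefl (deg p.1)) => d.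
elim: (mon_lt_wf ole d) p => {}d _ IH p ed pp.
have [p0|p0] := eqVneq p.1 0; first by exists p; split; [exact: rt_refl|left].
have [red|nred] := pselect (can_be_reduced le G p); last first.
  by exists p; split; [exact: rt_refl|right].
have [q pq] := one_step_exists dR ole pp p0 red.
have [pq' _ qd _] := one_step_rep ole pG pp pq.
have [q0|q0] := eqVneq q.1 0; first by exists q; split; [exact: rt_step|left].
have [|h [qh hP]] := IH (deg q.1) _ q erefl pq'.
  by rewrite -ed; apply: supp_lt_deg.
by exists h; split=> //; apply: rt_trans qh; exact: rt_step.
Qed.

(** * Replacing coefficients modulo N *)

(** The third conclusion lets h' stand in for h below the lcm of the treated pair; the fourth keeps
    h' inside the ideal generated by F. *)
Lemma coef_replacementP N G h h' : monomial_order le -> is_ideal N ->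
    (forall p, p \in G -> is_pseudo p) -> (1, ideal_in_frac N) \in G ->
    is_pseudo h -> is_minimal le G h -> coef_replacement N h h' ->
  [/\ is_pseudo h' /\ h'.1 != 0, ~ can_be_reduced le G h',
    forall z, h.2 z -> rep le (rcons G h') (fun m => le m (deg h.1)) (z *: h.1) &
    forall a, h'.2 a -> exists2 z, h.2 z & rep le G (fun=> True) (a *: h'.1 - z *: h.1)].
Proof.
move=> ole idN pG G1 ph [h0 nred] [g1 [g2 [A1 [pg1 g10 eA [sub12 cN] ->]]]] /=.
have sR := submodule_Rfrac R; have sN := submodule_ideal idN.
have [[_ [a1 A1a1 a10]] g1R] := pg1; move: A1a1 g1R => /= A1a1 g1R.
have AtoZ a : A1 a -> exists2 z, h.2 z & z *: h.1 = a *: g1.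
  move=> Aa; have : [set a *: g1 | a in A1] (a *: g1) by exists a.
  by rewrite eA.
have ZtoA z : h.2 z -> exists2 a, A1 a & a *: g1 = z *: h.1.
  move=> hz; have : [set z *: h.1 | z in h.2] (z *: h.1) by exists z.
  by rewrite -eA.
(* A non-zero a1 in A1 makes g1 proportional to h.1. *)
have dg1 : deg g1 = deg h.1.
  have [z hz e] := AtoZ _ A1a1; rewrite -(degZ ole a10 g10) -e degZ //.
  apply: contraNneq g10 => z0; move: e; rewrite z0 scale0r => /esym/eqP.
  by rewrite scaler_eq0 (negPf a10).
have diffN a k : A1 a -> ideal_in_frac N (a * (g1@_k - g2@_k)).
  move=> Aa; have [kg1|kg1] := boolP (k \in msupp g1).
    have [t [tP ->]] := cN k kg1; rewrite mulr_sumr; apply: submodule_sum_seq => // z /tP[Nz zA].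
    by rewrite mulrCA mulrC; case: sN => _ _; apply => //; apply: fid_inv_id Aa.
  have kg2 : k \notin msupp g2 by apply: contra kg1; apply: sub12.
  by rewrite !memN_msupp_eq0 // subrr mulr0; case: sN.
have NR : ideal_in_frac N `<=` Rf by move=> _ [r _ <-]; exists r.
have pg2 : is_pseudo (g2, A1).
  split; first by case: pg1.
  move=> a Aa k; have -> : a *: g2 = a *: g1 - a *: (g1 - g2).
    by rewrite -scalerBr opprB addrCA subrr addr0.
  rewrite mcoeffB; have [_ RD _] := sR; apply: RD; first exact: g1R.
  by apply: submoduleN => //; rewrite mcoeffZ mcoeffB; apply/NR/diffN.
pose D := sumset (lm_divides le h.1 (G := G)) (fun i => lc_ideal le (tuple_of i)).
have sD : is_submodule D.
  by apply: submodule_sumset => i _; apply/submodule_lc_ideal/pG/tuple_of_mem.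
(* The exponent 0 of (1, N) divides every leading exponent, so this member always takes part in
   D. *)
have ND : ideal_in_frac N `<=` D.
  have [i ei] := tuple_ofP G1; move=> x Nx; apply: (@sumset_mem _ _ _ _ i).
  - by move=> j _; apply/submodule_lc_ideal/pG/tuple_of_mem.
  - by rewrite /lm_divides ei /= deg1 //; apply/mnm_lepP => j; rewrite mnm0E.
  - by rewrite /= ei; exists x; rewrite //= lc1 // mulr1.
have nredD : ~ (forall a, A1 a -> D (a * g2@_(deg h.1))).
  move=> gD; apply: nred => _ [z hz <-]; have [a Aa e] := ZtoA z hz.
  rewrite -[z * _]mcoeffZ -e mcoeffZ -[g1@_(deg h.1)](subrK g2@_(deg h.1)) mulrDr.
  by have [_ DD _] := sD; apply: DD; [apply/ND/diffN|exact: gD].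
(* A zero coefficient would trivially lie in D, against [nredD]; hence the degree is preserved. *)
have g2d : g2@_(deg h.1) != 0.
  apply/eqP => e; apply: nredD => a _; rewrite e mulr0; by case: sD.
have dg2 : deg g2 = deg h.1.
  apply: deg_eq => // k; rewrite -mcoeff_msupp => /sub12.
  by rewrite mcoeff_msupp -dg1; apply: mcoeff_le_deg.
have repN a (Q : 'X_{1..n} -> Prop) : A1 a -> (forall k, le k (deg h.1) -> Q k) ->
    rep le G Q (a *: (g1 - g2)).
  move=> Aa leQ; apply: (rep_one ole G1).
    by move=> k; rewrite mcoeffZ mcoeffB; apply: diffN.
  move=> k kne; apply: leQ; rewrite -dg1; apply: mcoeff_le_deg => //.
  rewrite -mcoeff_msupp; apply: contraTT kne => kg1; rewrite mcoeffZ mcoeffB.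
  have kg2 : k \notin msupp g2 by apply: contra kg1; apply: sub12.
  by rewrite !memN_msupp_eq0 // subrr mulr0 eqxx.
split.
- by split=> //; apply: contraNneq g2d => ->; rewrite mcoeff0.
- by rewrite /can_be_reduced /= /lm_divides dg2 => red; apply: nredD => a Aa;
    rewrite -dg2; apply: red; exists a.
- move=> z hz; have [a Aa <-] := ZtoA z hz.
  have -> : a *: g1 = a *: (g1 - g2) + a *: ('X_[0] * g2).
    by rewrite mpolyX0 mul1r -scalerDr subrK.
  apply: repD; last first.
    apply: (@rep_term _ _ _ _ _ (g2, A1)) => //; first by rewrite mem_rcons inE eqxx.
    by rewrite add0m /= dg2; apply: mon_le_refl.
  apply: rep_mono (repN a _ Aa (fun k lek => lek)) => // p.
  by rewrite mem_rcons inE orbC => ->.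
- move=> a Aa; have [z hz e] := AtoZ a Aa; exists z => //.
  rewrite e -scalerBr -opprB scalerN -scaleNr; apply: repN => //.
  by apply: submoduleN => //; case: pg1 => /fractional_submodule.
Qed.

(** Leaving the coefficients unchanged is always allowed, so the replacement never blocks the
    loop. *)
Lemma coef_replacement_refl N h : is_pseudo h -> h.1 != 0 -> coef_replacement N h h.
Proof.
move=> ph h0; exists h.1, h.1, h.2; split=> //; try by case: h ph {h0}.
by split=> // m _; rewrite subrr; exact: combos0.
Qed.

(** * The loop invariant *)

(** F is the original family without (1, N), so the third clause confines the ideal generated by the
    current family to that of F. The last clause says that each pair of distinct members is pending
    or settled. *)
Definition invariant F N s : Prop :=
  [/\ forall p, p \in s.2 -> is_pseudo p /\ p.1 != 0,
      (1, ideal_in_frac N) \in s.2 /\ {subset F <= s.2},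
      forall p c, p \in s.2 -> p.2 c -> rep le F (fun=> True) (c *: p.1),
      forall p q, s.1 (p, q) -> p \in s.2 /\ q \in s.2 &
      forall p q, p \in s.2 -> q \in s.2 -> p <> q ->
        [\/ s.1 (p, q), s.1 (q, p) | spoly_rep le s.2 p q]].

Definition extends_or_shrinks s s' : Prop :=
  (exists x, s.1 x /\ s' = (s.1 `\ x, s.2)) \/
  (exists h, s'.2 = rcons s.2 h /\ ~ can_be_reduced le s.2 h).

Lemma spoly_repW G G' p q : {subset G <= G'} -> spoly_rep le G p q -> spoly_rep le G' p q.
Proof. by move=> GG pq z pz qz; apply: rep_mono (pq z pz qz). Qed.

Lemma step_invariant F N s s' : dedekind_domain R -> monomial_order le -> is_ideal N ->
  invariant F N s -> step le N s s' -> invariant F N s' /\ extends_or_shrinks s s'.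
Proof.
case: s => T G dR ole idN [/= pG [G1 FG] GF TG TS].
move=> [p [q [h0 [h [Tpq red min0 eh ->]]]]].
have [pinG qinG] := TG _ _ Tpq.
have [[pp p0] [pq q0]] := (pG _ pinG, pG _ qinG).
have ppG r : r \in G -> is_pseudo r by move=> /pG[].
have sG r : r \in G -> is_submodule r.2 by move=> /ppG[/fractional_submodule].
have [ph0 eh0 h0lt h0rep] := reduces_to_rep ole ppG red
  (is_pseudo_spoly dR ole pp p0 pq q0) (spoly_supp_lt ole p0 q0).
(* No degree bound is needed here: z times the S-polynomial is a combination of p and q, and the
   reduction subtracts further members. *)
have h0F z : h0.2 z -> rep le G (fun=> True) (z *: h0.1).
  rewrite eh0 => hz; have [[a pa ea] [b qb eb]] := hz.
  rewrite -[h0.1](subKr (spoly le p q).1) scalerBr -scaleNr.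
  have -> : (- z) *: ((spoly le p q).1 - h0.1) = (-1) *: (z *: ((spoly le p q).1 - h0.1)).
    by rewrite scalerA mulN1r.
  apply: repD.
    rewrite -ea (spolyE ole p0 q0 (etrans ea (esym eb))) -!scalerAr -scaleNr.
    apply: repD; first exact: rep_term.
    by apply: rep_term => //; apply: submoduleN => //; exact: sG.
  apply: repZ => //; first exact/RfracN/Rfrac1.
  by apply: rep_mono (h0rep z hz).
(* The reduction already represents the S-polynomial minus h0 below the lcm, so only h0 is left. *)
have good G' : {subset G <= G'} ->
    (forall z, h0.2 z -> rep le G' (fun m => mlt m (mlcm (deg p.1) (deg q.1))) (z *: h0.1)) ->
    spoly_rep le G' p q.
  move=> GG rh z pz qz; rewrite -[(spoly le p q).1](subrK h0.1) scalerDr.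
  apply: repD; last by apply: rh; rewrite eh0.
  by apply: rep_mono (h0rep z _).
have [h00|h0n] := eqVneq h0.1 0.
  rewrite h00 eqxx in eh; rewrite eh h00 eqxx; split; last by left; exists (p, q).
  split=> //=; first by move=> r t [/TG].
  have gpq : spoly_rep le G p q.
    by apply: good => // z _; rewrite h00 scaler0; exact: rep_nil.
  move=> r t rG tG rt; case: (TS r t rG tG rt) => [Trt|Ttr|]; last by constructor 3.
    have [[-> ->]|ne] := pselect ((r, t) = (p, q)); first by constructor 3.
    by constructor 1.
  have [[-> ->]|ne] := pselect ((t, r) = (p, q)); last by constructor 2.
  by constructor 3; apply: spoly_rep_sym.
case: min0 => [/eqP|minh0]; first by rewrite (negPf h0n).
rewrite (negPf h0n) in eh.
have [[ph hn] nred hrep hF] := coef_replacementP ole idN ppG G1 ph0 minh0 eh.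
rewrite (negPf hn); split; last by right; exists h.
have GG : {subset G <= rcons G h} by move=> r; rewrite mem_rcons inE orbC => ->.
have gpq : spoly_rep le (rcons G h) p q.
  apply: good => // z /hrep; apply: rep_mono => // k kle.
  by apply: mon_le_lt_trans kle _ => //; apply: supp_lt_deg.
split=> /=.
- by move=> r; rewrite mem_rcons inE => /orP[/eqP->|/pG].
- by split=> [|r /FG]; exact: GG.
- move=> r c; rewrite mem_rcons inE => /orP[/eqP->|rG] rc; last exact: GF.
  (* Split c h as (c h - z h0) + z h0; the first part comes from (1, N), the second from the
     S-polynomial. *)
  apply: (rep_trans GF); have [z hz rz] := hF c rc.
  by rewrite -(subrK (z *: h0.1) (c *: h.1)); apply: repD => //; apply: h0F.
- move=> r t [[/TG[rG tG] _]|[f fG [<- <-]]].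
    by split; apply: GG.
  by split; [apply: GG|rewrite mem_rcons inE eqxx].
- move=> r t; rewrite !mem_rcons !inE => /orP[/eqP->|rG] /orP[/eqP->|tG] rt //.
  + by constructor 2; right; exists t.
  + by constructor 1; right; exists r.
  case: (TS r t rG tG rt) => [Trt|Ttr|grt]; last by constructor 3; apply: spoly_repW grt.
    have [[-> ->]|ne] := pselect ((r, t) = (p, q)); first by constructor 3.
    by constructor 1; left.
  have [[-> ->]|ne] := pselect ((t, r) = (p, q)); last by constructor 2; left.
  constructor 3; apply: spoly_rep_sym => // u.
  by rewrite mem_rcons inE => /orP[/eqP->|/sG//]; case: ph => /fractional_submodule.
Qed.

Lemma runs_invariant F N s s' : dedekind_domain R -> monomial_order le -> is_ideal N ->
  runs_to le N s s' -> invariant F N s -> invariant F N s'.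
Proof.
move=> dR ole idN; elim=> {s s'} [s s' st inv|//|s t u _ IH _ IH' inv].
  by have [] := step_invariant dR ole idN inv st.
exact: IH' (IH inv).
Qed.

Lemma initial_invariant F N T0 : dedekind_domain R -> monomial_order le ->
    (forall p, p \in F -> is_pseudo p /\ p.1 != 0) -> is_ideal N ->
    (exists2 a, N a & a != 0) -> (forall a, N a -> gen F (tofrac a)%:MP) ->
    initial_pairs (rcons F (1, ideal_in_frac N)) T0 ->
  invariant F N (T0, rcons F (1, ideal_in_frac N)).
Proof.
move=> [nR _ _] ole pF idN [a Na a0] NF [T0F FT0].
split=> /=.
- move=> p; rewrite mem_rcons inE => /orP[/eqP-> /=|/pF//].
  split; last exact: oner_neq0.
  split=> /=.
    apply: (@fractionalP _ _ 1) => //; first exact: submodule_ideal.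
    + exact: oner_neq0.
    + by move=> _ [r _ <-]; exists r; rewrite ?mul1r.
    + by exists (tofrac a); [exists a|rewrite tofrac_eq0].
  move=> _ [r Nr <-] k; rewrite mcoeffZ mcoeff1; case: eqP => _; rewrite ?mulr1 ?mulr0.
    by exists r.
  by case: (submodule_Rfrac R).
- by split=> [|p pF']; rewrite mem_rcons inE ?eqxx // pF' orbT.
- move=> p c; rewrite mem_rcons inE => /orP[/eqP-> /=|pF' pc].
    by move=> [r /NF gr <-]; rewrite -mul_mpolyC mulr1; apply: gen_rep.
  by rewrite -[p.1]mul1r -mpolyX0; apply: rep_term.
- by move=> p q /T0F[].
- by move=> p q pF' qF' pq; case: (FT0 p q pF' qF' pq) => ?; [constructor 1|constructor 2].
Qed.

(** * Termination *)

(** The first component of a state is an arbitrary set; the invariant confines it to pairs of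
    members, so counting over the list of all such pairs measures it. *)
Definition pending s : nat := size [seq x <- allpairs pair s.2 s.2 | `[< s.1 x >]].

(** The list may repeat x, so the drop need not be by exactly one. *)
Lemma count_setD1 (X : eqType) (S : set X) (x : X) (l : seq X) : x \in l -> S x ->
  (count (fun y => `[< (S `\ x) y >]) l < count (fun y => `[< S y >]) l)%N.
Proof.
move=> + Sx; elim: l => // y l IH.
have le_count l' : (count (fun y => `[< (S `\ x) y >]) l' <= count (fun y => `[< S y >]) l')%N.
  by apply: sub_count => z /asboolP[Tz _]; apply/asboolP.
rewrite inE => /orP[/eqP<-|/IH lt_count] /=.
  have -> : `[< S x >] by apply/asboolP.
  have -> : `[< (S `\ x) x >] = false by apply/asboolP => -[_ /=]; apply.
  by rewrite add0n add1n ltnS.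
rewrite -addnS leq_add //.
by have := le_count [:: y]; rewrite /= !addn0.
Qed.

Lemma pending_decreases F N s x : invariant F N s -> s.1 x ->
  (pending (s.1 `\ x, s.2) < pending s)%N.
Proof.
case: x => p q [_ _ _ TG _] Tx; have [pinG qinG] := TG p q Tx.
rewrite /pending !size_filter; apply: count_setD1 => //.
by apply/allpairsP; exists (p, q).
Qed.

Lemma no_infinite_run F N (run : nat -> state) : dedekind_domain R -> monomial_order le ->
    is_ideal N -> invariant F N (run 0%N) -> (forall k : nat, step le N (run k) (run k.+1)) -> False.
Proof.
move=> dR ole idN inv0 runS.
have inv (k : nat) : invariant F N (run k).
  by elim: k => // k IH; have [] := step_invariant dR ole idN IH (runS k).
have cases (k : nat) : extends_or_shrinks (run k) (run k.+1).
  by have [] := step_invariant dR ole idN (inv k) (runS k).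
have mono i j : (i <= j)%N -> {subset (run i).2 <= (run j).2}.
  move=> /subnK<-; elim: (j - i)%N => // l IH p /IH /= pl.
  case: (cases (l + i)%N) => [[x [_ ->]]//|[h [-> _]]].
  by rewrite mem_rcons inE pl orbT.
have grow (k : nat) : exists j, (k <= j)%N /\
    exists h, (run j.+1).2 = rcons (run j).2 h /\ ~ can_be_reduced le (run j).2 h.
  have [l] := ubnP (pending (run k)); elim: l k => // l IH k.
  case: (cases k) => [[x [Tx e]]|[h hP] _]; last by exists k; split=> //; exists h.
  rewrite ltnS => kl; have [|j [kj hP]] := IH k.+1.
    by rewrite e; apply: leq_trans (pending_decreases (inv k) Tx) kl.
  by exists j; split=> //; exact: ltnW.
have [next nextP] := choice grow.
(* Enumerates infinitely many steps that add a member; below, h j is the member added at step t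
   j. *)
pose t := fix t j := if j is j'.+1 then next (t j').+1 else next 0%N.
have tP j : exists h, (run (t j).+1).2 = rcons (run (t j)).2 h
    /\ ~ can_be_reduced le (run (t j)).2 h.
  by case: j => [|j]; [exact: (nextP 0%N).2|exact: (nextP (t j).+1).2].
have t_lt : forall i j, (i < j)%N -> (t i < t j)%N.
  by apply: nat_increasing => j; exact: (nextP (t j).+1).1.
have [h hP] := choice tP.
have hpseudo (k : nat) : is_pseudo (h k).
  have [/(_ (h k)) + _ _ _ _] := inv (t k).+1; case=> //.
  by rewrite (hP k).1 mem_rcons inE eqxx.
have [nR _ _] := dR.
pose A (k : nat) := lc_ideal le (h k).
pose D (k : nat) := sumset (lm_divides le (h k).1 (G := (run (t k)).2))
  (fun i => lc_ideal le (tuple_of i)).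
have sT (k : nat) (i : 'I_(size (run k).2)) : is_submodule (lc_ideal le (tuple_of i)).
  by apply: submodule_lc_ideal; have [/(_ _ (tuple_of_mem i))[]] := inv k.
apply: (@no_bad_sequence R n (fun k : nat => deg (h k).1) A D) => //.
- by move=> k; apply: submodule_lc_ideal.
- by move=> k; apply: lc_ideal_Rfrac.
- by move=> k; apply: submodule_sumset => i _; apply: sT.
(* The member h j is present from state (t j).+1 on, and (t j).+1 <= t k. *)
- move=> j k jk djk x Ax; have hjk : h j \in (run (t k)).2.
    by apply: (mono _ _ (t_lt j k jk)); rewrite (hP j).1 mem_rcons inE eqxx.
  have [i ei] := tuple_ofP hjk; apply: (@sumset_mem _ _ _ _ i) => //.
  + by rewrite /lm_divides ei.
  + by rewrite ei.
- by move=> k; exact: (hP k).2.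
Qed.

(** * Leading term ideals and the final family *)

Lemma Lt_famD G f g : (forall p, p \in G -> is_submodule p.2) ->
  Lt_fam le G f -> Lt_fam le G g -> Lt_fam le G (f + g).
Proof.
move=> sG [y [yP ->]] [z [zP ->]]; exists (fun i => y i + z i).
rewrite big_split; split=> // i _; have [a aP <-] := yP i isT; have [b bP <-] := zP i isT.
exists (a + b); last by rewrite mulrDl.
by apply: polys_inD => //; exact: sG _ (tuple_of_mem i).
Qed.

Lemma Lt_fam0 G : (forall p, p \in G -> is_submodule p.2) -> Lt_fam le G 0.
Proof.
move=> sG; exists (fun=> 0); split; last by rewrite big1.
by move=> i _; exists 0; rewrite ?mul0r //; exact: polys_in0 (sG _ (tuple_of_mem i)).
Qed.

Lemma Lt_famM G r f : (forall p, p \in G -> is_submodule p.2) -> polys_in Rf r ->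
  Lt_fam le G f -> Lt_fam le G (r * f).
Proof.
move=> sG Rr [y [yP ->]]; exists (fun i => r * y i); rewrite mulr_sumr; split=> // i _.
have [a aP <-] := yP i isT; exists (r * a); last by rewrite mulrA.
by apply: polys_inM => //; exact: sG _ (tuple_of_mem i).
Qed.

(** A non-zero term times lt g is the leading term of that term times g; for an admissible
    coefficient this product lies in the ideal generated by F. *)
Lemma Lt_fam_sub_ideal F G : monomial_order le ->
    (forall p, p \in F -> is_submodule p.2) -> (forall p, p \in G -> p.1 != 0) ->
    (forall p c, p \in G -> p.2 c -> rep le F (fun=> True) (c *: p.1)) ->
  Lt_fam le G `<=` Lt_ideal le (gen F).
Proof.
move=> ole sF G0 GF _ [y [yP ->]].
have combos_sum (I : Type) (r : seq I) (P : pred I) (E : I -> Kx) :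
    (forall i, P i -> Lt_ideal le (gen F) (E i)) ->
    Lt_ideal le (gen F) (\sum_(i <- r | P i) E i).
  by move=> EP; apply: (big_ind (Lt_ideal le (gen F))) => //; [exact: combos0|exact: combosD].
apply: (combos_sum) => i _; have [a aG <-] := yP i isT; have iG := tuple_of_mem i.
have g0 := G0 _ iG; rewrite [a]mpolyE mulr_suml big_seq; apply: combos_sum => m.
rewrite mcoeff_msupp => am0; rewrite -[_ * lt _ _]mul1r.
have XG0 : 'X_[m] * (tuple_of i).1 != 0.
  by rewrite mulf_neq0 // -msupp_eq0 msuppX.
have -> : (a@_m *: 'X_[m]) * lt le (tuple_of i).1 =
    lt le (a@_m *: ('X_[m] * (tuple_of i).1)).
  rewrite /lt /lm /Defs.lc degZ // degXM // mcoeffZ mcoeffXM.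
  by rewrite -scalerAl -scalerAr scalerA mpolyXD.
apply: combos_mem; first by rewrite -mpolyX0; apply: polys_inX.
exists (a@_m *: ('X_[m] * (tuple_of i).1)) => //; split; last first.
  by rewrite scaler_eq0 negb_or am0.
apply: (rep_gen sF); rewrite scalerAr.
by apply: repXM (GF _ _ iG (aG m)).
Qed.

Lemma groebner_of_invariant F N G : dedekind_domain R -> monomial_order le ->
    (forall p, p \in F -> is_submodule p.2) ->
  invariant F N (set0, G) -> pseudo_groebner_basis le G (gen F).
Proof.
move=> dR ole sF [/= pG [_ FG] GF _ TS].
have sG p : p \in G -> is_submodule p.2 by move=> /pG[[/fractional_submodule]].
split=> //; first by move=> f /(gen_rep le)/(rep_trans GF)/(rep_gen sF).
have good p q : p \in G -> q \in G -> spoly_rep le G p q.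
  (* Equal pairs are never listed by the procedure; their S-polynomial is 0. *)
  move=> pinG qinG; have [->|pq] := pselect (p = q); last by case: (TS p q pinG qinG pq).
  by move=> z _ _; rewrite /spoly subrr scaler0; exact: rep_nil.
apply/seteqP; split; last by apply: Lt_fam_sub_ideal => // p /pG[].
move=> _ [s [sP ->]]; rewrite big_seq.
apply: (big_ind (Lt_fam le G)); [exact: Lt_fam0|by move=> *; apply: Lt_famD|].
move=> z /sP[Rz [f [/(gen_rep le) Ff f0] <-]]; apply: Lt_famM => //.
by apply: rep_lt => //; apply: rep_mono Ff.
Qed.

Lemma progress F N T G : dedekind_domain R -> monomial_order le ->
  invariant F N (T, G) -> T !=set0 -> exists s, step le N (T, G) s.
Proof.
move=> dR ole [/= pG _ _ TG _] [[p q] Tpq]; have [pinG qinG] := TG p q Tpq.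
have [[pp p0] [pq q0]] := (pG _ pinG, pG _ qinG).
have ppG r : r \in G -> is_pseudo r by move=> /pG[].
have psp := is_pseudo_spoly dR ole pp p0 pq q0.
have [h [red hmin]] := reduction_exists dR ole ppG psp.
have [ph _ _ _] := reduces_to_rep ole ppG red psp (spoly_supp_lt ole p0 q0).
eexists; exists p, q, h, h; split=> //.
by case: eqP => // /eqP h0; apply: coef_replacement_refl.
Qed.

End Algorithm.

(** The free choices make [step] a relation. The first two conclusions together give termination: no
    run is infinite, and none is stuck while pairs remain. *)
Theorem corollary5p2 (R : idomainType) (n : nat) (le : rel 'X_{1..n})
    (F : seq (pseudo R n)) (N : set R)
    (T0 : set (pseudo R n * pseudo R n)) :
  dedekind_domain R ->
  monomial_order le ->
  (forall p, p \in F -> is_pseudo p /\ p.1 != 0) ->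
  is_ideal N -> (exists2 a, N a & a != 0) ->
  (forall a, N a -> gen F (tofrac a)%:MP) ->
  let F1 := rcons F (1, ideal_in_frac N) in
  initial_pairs F1 T0 ->
  [/\ ~ (exists run : nat -> state R n,
           run 0%N = (T0, F1) /\ forall k, step le N (run k) (run k.+1)),
      forall T G, runs_to le N (T0, F1) (T, G) -> T !=set0 ->
        exists s, step le N (T, G) s
    & forall G, runs_to le N (T0, F1) (set0, G) ->
        pseudo_groebner_basis le G (gen F)].
Proof.
move=> dR ole pF idN N0 NF F1 T0P.
have inv0 : invariant le F N (T0, F1) by apply: initial_invariant.
have sF p : p \in F -> is_submodule p.2 by move=> /pF[[/fractional_submodule]].
split.
- by move=> [run [run0 runS]]; apply: (no_infinite_run (F := F) dR ole idN _ runS); rewrite run0.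
- by move=> T G /(runs_invariant dR ole idN)/(_ inv0); apply: progress.
- by move=> G /(runs_invariant dR ole idN)/(_ inv0); apply: groebner_of_invariant.
Qed.
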